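(* Let $K,n_T,n_R\ge 1$ be integers, let $T=n_T$, and let $\mathsf{SNR}>0$. For each user $k\in\{1,\dots,K\}$ let $\mathbf{H}_k=(h^k_{i,j})$ be an $n_R\times n_T$ random matrix, where all entries $h^k_{i,j}$ (over all $k,i,j$) are i.i.d. circularly-symmetric complex Gaussian $\mathcal{CN}(0,1)$. Define the ergodic sum-rate of cyclic delay diversity $$R_c=\mathbb{E}\left[\frac{1}{T}\log_2\det\left(\mathbf{I}_{n_Rn_T}+\frac{\mathsf{SNR}}{n_T}\tilde{\mathbf{H}}\tilde{\mathbf{H}}^H\right)\right],$$ where $\tilde{\mathbf{H}}$ is the effective channel defined in the context. Then $$R_c\ \ge\ \sum_{l=1}^{L}\log_2\left(1+\mathsf{SNR}\,\exp\left(\sum_{k=1}^{M-l}\frac1k-\gamma\right)\right),$$ where $L=\min(n_R,K)$, $M=\max(n_R,K)$, $\gamma\approx0.5772$ is the Euler–Mascheroni constant, and an empty sum equals $0$.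
   Context: Multi-user multiple access channel: $K$ users, each with $n_T$ transmit antennas, a base station with $n_R$ receive antennas; received signal $\mathbf{Y}=\sum_{k=1}^K\sqrt{\mathsf{SNR}/n_T}\,\mathbf{G}_k\mathbf{H}_k^T+\mathbf{N}$ with noise entries i.i.d. $\mathcal{CN}(0,1)$, block length $T=n_T$, and each user $k$ transmits the $T\times T$ cyclic delay diversity (circulant) matrix $\mathbf{G}_k$ whose first row is $(x_1,\dots,x_T)$ and each subsequent row is the previous row cyclically shifted right by one position, with Gaussian codebook inputs. Effective channel: for user $k$ and receive antenna $i$, let $\tilde{\mathbf{H}}_{k,i}$ be the $T\times T$ matrix with $(r,s)$ entry $h^k_{i,\,((r+s-2)\bmod T)+1}$ (so its first row is $(h^k_{i,1},\dots,h^k_{i,T})$ and each next row is the previous one cyclically shifted left by one). Let $\tilde{\mathbf{H}}_k=[\tilde{\mathbf{H}}_{k,1}^T,\dots,\tilde{\mathbf{H}}_{k,n_R}^T]^T$ (size $n_Rn_T\times n_T$) and $\tilde{\mathbf{H}}=[\tilde{\mathbf{H}}_1,\dots,\tilde{\mathbf{H}}_K]$ (size $n_Rn_T\times n_TK$). The receiver uses joint maximum-likelihood detection with full channel knowledge. *)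

(* Defs.v *)
From HB Require Import structures.
From mathcomp Require Import all_boot all_order all_algebra.
From mathcomp Require Import all_classical all_reals all_analysis.
From mathcomp Require Import complex.
Set Implicit Arguments. Unset Strict Implicit. Unset Printing Implicit Defensive.
Import Order.TTheory GRing.Theory Num.Theory.
Local Open Scope classical_set_scope.
Local Open Scope ring_scope.

Definition euler_gamma {R : realType} : R :=
  limn (fun n : nat => \sum_(1 <= k < n.+1) (k%:R : R)^-1 - ln (n%:R : R)).

(* Mutual independence of a finite family of real random variables:
   P(\bigcap_i X_i^{-1}(B_i)) = \prod_i P(X_i^{-1}(B_i)) for all Borel B_i
   (subfamilies are obtained by taking B_i = setT). *)
Definition mutually_independent {d} {Omega : measurableType d} {R : realType}
  (P : probability Omega R) (I : finType) (X : I -> Omega -> R) : Prop :=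
  forall B : I -> set R, (forall i, measurable (B i)) ->
    P (\bigcap_i (X i @^-1` B i)) = (\prod_(i : I) P (X i @^-1` B i))%E.

(* X has the real normal law N(m, s^2) (s = standard deviation). *)
Definition has_normal_law {d} {Omega : measurableType d} {R : realType}
  (P : probability Omega R) (X : Omega -> R) (m s : R) : Prop :=
  measurable_fun setT X /\
  forall A : set R, measurable A -> P (X @^-1` A) = normal_prob m s A.

Lemma ord_pos n (r : 'I_n) : (0 < n)%N.
Proof. exact: leq_ltn_trans (leq0n r) (ltn_ord r). Qed.

Definition addmod n (r s : 'I_n) : 'I_n :=
  Ordinal (ltn_pmod (r + s) (ord_pos r)).

Local Open Scope complex_scope.

Definition Htilde_blk {R : rcfType} (nT : nat) (hrow : 'I_nT -> R[i]) : 'M[R[i]]_nT :=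
  \matrix_(r < nT, s < nT) hrow (addmod r s).

Definition Htilde {R : rcfType} (K nR nT : nat) (h : 'I_K -> 'I_nR -> 'I_nT -> R[i]) :
  'M[R[i]]_(\sum_(i < nR) nT, \sum_(k < K) nT) :=
  \mxblock_(i < nR, k < K) Htilde_blk (h k i).

Definition adjmx {R : rcfType} m n (A : 'M[R[i]]_(m, n)) : 'M[R[i]]_(n, m) :=
  map_mx (@conjc R) A^T.

(* The instantaneous CDD sum rate (1/T) log2 det(I + SNR/nT * Ht Ht^H);
   the determinant is a positive real, we take its real part. *)
Definition cdd_rate {R : realType} (K nR nT : nat) (snr : R)
  (h : 'I_K -> 'I_nR -> 'I_nT -> R[i]) : R :=
  let Ht := Htilde h in
  (nT%:R)^-1 * (ln (complex.Re (\det (1%:M + ((snr / nT%:R)%:C) *: (Ht *m adjmx Ht)))) / ln 2).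

(* Main.v *)
Require Import Defs.
From HB Require Import structures.
From mathcomp Require Import all_boot all_order all_algebra.
From mathcomp Require Import all_classical all_reals all_analysis.
From mathcomp Require Import measurable_realfun complex.
From mathcomp Require Import perm cyclic separable cyclotomic.
From mathcomp Require Import ring lra.
Set Implicit Arguments.
Unset Strict Implicit.
Unset Printing Implicit Defensive.
Import Order.TTheory GRing.Theory Num.Theory.
Import numFieldNormedType.Exports.
Local Open Scope classical_set_scope.
Local Open Scope ring_scope.

(** Conjugating the blocks by the discrete Fourier matrix turns every
    left-circulant block into a diagonal one, so the determinant factors over
    the [nT] frequencies into Gram determinants [det (I + snr G_t G_t^H)], and
    by rotation invariance each [G_t] again has i.i.d. [CN(0,1)] entries.

    For one such matrix, with the smaller dimension as rows, a unitary matrix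
    depending on the first row only moves this row to a multiple of [e_0]
    without changing the law of the other rows; a Schur complement then splits
    off the factor [1 + snr |g|^2] of the first row [g], up to a nonnegative rank
    one term, and the rest is a Gaussian matrix with one row and one column less.

    Since [x |-> ln (1 + snr exp x)] is convex, it remains to bound [E ln |g|^2]
    from below by [H_(M-1) - gamma].  The variable [S = |g|^2] enters only
    through its Laplace transform [(1 + t)^-k]: Frullani's integral gives
    [E ln (S_(k+1) / S_k) = 1/k] when an exponential variable is added to [S_k],
    and [ln y >= 1 - 1/y] gives [E ln S_n >= ln n - 1/(n-1)], so that the bound
    follows from [H_n - ln n --> gamma]. *)

(** * Laws of independent Gaussian families *)

(** The unitary that moves the first row depends on that row, so invariance under a fixed unitary
    does not apply to it directly. Since independence and the marginals determine the joint law, the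
    first row and the remaining rows may be read on the two factors of a product space. For a frozen
    first row the unitary is then a constant matrix, Tonelli's theorem does the rest, and the choice
    of the unitary never has to be measurable. The same transfer to a product space yields rotation
    invariance and the Laplace transform of the squared norm. Invariance is proved for phases and
    real plane rotations only; their products already bring any vector onto the first axis.

    All integrands are kept non-negative, so that no integrability has to be checked: log
    determinants are at least 0, and [ln |g|^2] occurs only inside a supporting line lying below
    such an integrand. That line touches the convex function at the very value that bounds
    [E ln |g|^2], so its linear part contributes nothing negative to the final bound. *)

Section density.
Context d (T : measurableType d) (R : realType).
Import HBNNSimple.
Local Open Scope ereal_scope.

(** Holds for indicators by hypothesis, hence for simple functions, hence for [f] by monotone
    convergence. It turns integrals against the normal and exponential laws into Lebesgue
    integrals. *)
Lemma ge0_integral_density (mu nu : {measure set T -> \bar R}) (g : T -> R)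
    (f : T -> \bar R) :
  measurable_fun [set: T] g -> (forall x, (0 <= g x)%R) ->
  (forall A, measurable A -> nu A = \int[mu]_(x in A) (g x)%:E) ->
  measurable_fun [set: T] f -> (forall x, 0 <= f x) ->
  \int[nu]_x f x = \int[mu]_x (f x * (g x)%:E).
Proof.
move=> mg g0 nuE mf f0.
have mgE : measurable_fun [set: T] (EFin \o g) by exact/measurable_EFinP.
pose f_ := nnsfun_approx measurableT mf.
have fE x : f x = limn (fun n => (f_ n x)%:E).
  by apply/esym/cvg_lim => //; apply: cvg_nnsfun_approx.
transitivity (limn (fun n => \int[nu]_x (f_ n x)%:E)).
  rewrite -monotone_convergence//=; first by apply: eq_integral => x _.
  - by move=> n; exact/measurable_EFinP/measurable_funP.
  - by move=> n x _; rewrite lee_fin.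
  - by move=> x _ m n mn; rewrite lee_fin; exact/lefP/nd_nnsfun_approx.
transitivity (limn (fun n => \int[mu]_x ((f_ n x)%:E * (g x)%:E))); last first.
  rewrite -monotone_convergence//=.
  - apply: eq_integral => x _; apply/cvg_lim => //.
    by apply: cvgeMr => //; apply: cvg_nnsfun_approx.
  - move=> n; apply: emeasurable_funM => //.
    exact/measurable_EFinP/measurable_funP.
  - by move=> n x _; rewrite mule_ge0 ?lee_fin.
  - move=> x _ m n mn; apply: lee_wpmul2r; rewrite lee_fin//.
    exact/lefP/nd_nnsfun_approx.
congr (limn _); apply/funext => n; rewrite integralT_nnsfun.
under [RHS]eq_integral => x _.
  rewrite fimfunE -fsumEFin// ge0_mule_fsuml; last first.
    by move=> r; rewrite nnfun_muleindic_ge0.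
  over.
rewrite ge0_integral_fsum//; last 2 first.
- move=> r; apply: emeasurable_funM => //.
  by apply/measurable_EFinP; apply: measurable_funM.
- by move=> r x _; rewrite mule_ge0 ?nnfun_muleindic_ge0 ?lee_fin.
rewrite sintegralE; apply: eq_fsbigr => r _.
have mr : measurable (f_ n @^-1` [set r]) by exact: measurable_sfunP.
rewrite nuE//.
have [r0|r0] := leP 0%R r; last first.
  rewrite preimage_nnfun0//= integral_set0 mule0 integral0_eq// => x _.
  by rewrite indic0 mulr0 mul0e.
rewrite integral_mkcond/= -ge0_integralZl//; last 2 first.
- by apply/(measurable_restrictT _ _).1 => //; exact: measurable_funTS.
- by move=> x _; rewrite erestrict_ge0//= => y _; rewrite lee_fin.
apply: eq_integral => x _; rewrite patchE indicE /=.
by case: ifPn => _; rewrite ?mulr1 ?mulr0 ?mule0 ?mul0e.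
Qed.

End density.

(** Measurable boxes: they generate the product sigma-algebra on [I -> R], and mutual independence
    prescribes the probability of exactly these sets. *)
Definition cylinders (R : realType) (I : finType) : set (set (I -> R)) :=
  [set C | exists2 B : I -> set R, forall i, measurable (B i)
         & C = \bigcap_i [set x | B i (x i)]].

(** The variance 1/2 is that of the real and imaginary parts of a [CN(0,1)] variable. *)
Definition gaussian_family d (Omega : measurableType d) (R : realType)
    (P : probability Omega R) (I : finType) (X : I -> Omega -> R) : Prop :=
  mutually_independent P X /\
  forall i, has_normal_law P (X i) 0 (Num.sqrt 2^-1).
Arguments gaussian_family {d Omega R} P {I} X.

Section families.
Context (R : realType) (I : finType).
Notation family := (g_sigma_algebraType (@cylinders R I)).

Lemma setI_closed_cylinders : setI_closed (@cylinders R I).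
Proof.
move=> _ _ [A mA ->] [B mB ->]; exists (fun i => A i `&` B i).
  by move=> i; exact: measurableI.
by rewrite -bigcapI.
Qed.

Lemma cylindersT : @cylinders R I setT.
Proof.
exists (fun=> setT) => [i|]; first exact: measurableT.
by apply/seteqP; split.
Qed.

Lemma measurable_coord (i : I) :
  measurable_fun [set: family] (fun x : family => x i).
Proof.
move=> _ B mB; rewrite setTI; apply: sub_sigma_algebra.
exists (fun j => if j == i then B else setT).
  by move=> j; case: ifP => _ //; exact: measurableT.
apply/seteqP; split=> [x Bx j _ /=|x]; first by case: eqP => [->|].
by move=> /(_ i Logic.I)/=; rewrite eqxx.
Qed.

Lemma measurable_family d (Omega : measurableType d) (X : I -> Omega -> R) :
  (forall i, measurable_fun setT (X i)) ->
  @measurable_fun _ _ Omega family setT (fun w i => X i w).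
Proof.
move=> mX; apply: (@measurability _ _ Omega family _ _ (@cylinders R I)).
  by [].
move=> _ [_ [B mB ->] <-].
rewrite setTI (_ : _ @^-1` _ = \bigcap_i (X i @^-1` B i))//.
apply: fin_bigcap_measurable; first exact: finite_finset.
by move=> i _; rewrite -[X in measurable X]setTI; exact: mX.
Qed.

(** The two push-forwards agree on boxes, which are stable under intersection and generate the
    sigma-algebra, so the joint laws coincide even when the underlying probability spaces differ. *)
Lemma gaussian_family_event d (Omega : measurableType d) (P : probability Omega R)
    d' (Omega' : measurableType d') (P' : probability Omega' R)
    (X : I -> Omega -> R) (X' : I -> Omega' -> R) (C : set family) :
  gaussian_family P X -> gaussian_family P' X' -> measurable C ->
  P [set w | C (fun i => X i w)] = P' [set w | C (fun i => X' i w)].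
Proof.
move=> [iX nX] [iX' nX'] mC.
have mX := measurable_family (fun i => (nX i).1).
have mX' := measurable_family (fun i => (nX' i).1).
pose Y : Omega -> family := fun w i => X i w.
pose Y' : Omega' -> family := fun w i => X' i w.
apply: (@measure_unique _ _ family (@cylinders R I) (fun=> setT) _ _ _ _
  (pushforward P Y) (pushforward P' Y')) => //.
- exact: setI_closed_cylinders.
- by move=> _; exact: cylindersT.
- by apply/seteqP; split=> // x _; exists 0%N.
- move=> _ [B mB ->]; rewrite /pushforward/=.
  change (P (\bigcap_i (X i @^-1` B i)) = P' (\bigcap_i (X' i @^-1` B i))).
  rewrite iX// iX'//; apply: eq_bigr => i _.
  by rewrite (nX i).2// (nX' i).2.
- by move=> _; rewrite /= /pushforward preimage_setT probability_setT ltry.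
Qed.

Lemma gaussian_family_law d (Omega : measurableType d) (P : probability Omega R)
    d' (Omega' : measurableType d') (P' : probability Omega' R)
    (X : I -> Omega -> R) (X' : I -> Omega' -> R) (f : family -> \bar R) :
  gaussian_family P X -> gaussian_family P' X' ->
  measurable_fun [set: family] f -> (forall x, (0 <= f x)%E) ->
  (\int[P]_w f (fun i => X i w) = \int[P']_w f (fun i => X' i w))%E.
Proof.
move=> gX gX' mf f0.
have mX := measurable_family (fun i => (gX.2 i).1).
have mX' := measurable_family (fun i => (gX'.2 i).1).
pose Y : Omega -> family := fun w i => X i w.
pose Y' : Omega' -> family := fun w i => X' i w.
have := @ge0_integral_pushforward _ _ _ _ _ _ mX P setT f measurableT mf.
rewrite preimage_setT /= => <-; last by move=> x _; exact: f0.
have := @ge0_integral_pushforward _ _ _ _ _ _ mX' P' setT f measurableT mf.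
rewrite preimage_setT /= => <-; last by move=> x _; exact: f0.
apply: (@eq_measure_integral _ _ _ _ (pushforward P' Y') (pushforward P Y)).
by move=> A mA _; exact: gaussian_family_event.
Qed.

Lemma measurable_preimT d (Omega : measurableType d) d' (T : measurableType d')
    (f : Omega -> T) (A : set T) :
  measurable_fun setT f -> measurable A -> measurable (f @^-1` A).
Proof. by move=> mf mA; rewrite -[X in measurable X]setTI; exact: mf. Qed.

Lemma prod_probability_fst d (Omega : measurableType d) (P : probability Omega R)
    d' (Omega' : measurableType d') (P' : probability Omega' R) (A : set Omega) :
  measurable A -> ((P \x P') (fst @^-1` A) = P A)%E.
Proof.
move=> mA; rewrite (_ : _ @^-1` _ = A `*` setT).
  by rewrite product_measure1E// [X in (_ * X)%E](probability_setT P') mule1.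
by apply/seteqP; split=> [x ?|x []].
Qed.

Lemma prod_probability_snd d (Omega : measurableType d) (P : probability Omega R)
    d' (Omega' : measurableType d') (P' : probability Omega' R) (A : set Omega') :
  measurable A -> ((P \x P') (snd @^-1` A) = P' A)%E.
Proof.
move=> mA; rewrite (_ : _ @^-1` _ = setT `*` A).
  by rewrite product_measure1E// [X in (X * _)%E](probability_setT P) mul1e.
by apply/seteqP; split=> [x ?|x []].
Qed.

(** Reading the coordinates in [D] on one factor and the others on a second factor does not change
    the joint law, and it makes Tonelli's theorem available between the two groups. *)
Lemma gaussian_family_split d (Omega : measurableType d) (P : probability Omega R)
    d' (Omega' : measurableType d') (P' : probability Omega' R)
    (D : pred I) (X : I -> Omega -> R) (X' : I -> Omega' -> R) :
  gaussian_family P X -> gaussian_family P' X' ->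
  gaussian_family (P \x P')%E (fun i w => if D i then X i w.1 else X' i w.2).
Proof.
move=> [iX nX] [iX' nX'].
have mX i := (nX i).1; have mX' i := (nX' i).1.
have law i (A : set R) : measurable A ->
  (P \x P')%E ((fun w => if D i then X i w.1 else X' i w.2) @^-1` A) =
  if D i then P (X i @^-1` A) else P' (X' i @^-1` A).
  move=> mA; case: (D i).
    exact/(@prod_probability_fst _ _ P)/measurable_preimT.
  exact/(@prod_probability_snd _ _ P)/measurable_preimT.
split=> [B mB|i]; last split=> [|A mA].
- pose B1 i := if D i then B i else setT.
  pose B2 i := if D i then setT else B i.
  have mB1 i : measurable (B1 i) by rewrite /B1; case: ifP.
  have mB2 i : measurable (B2 i) by rewrite /B2; case: ifP.
  rewrite (_ : \bigcap_i _ =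
    (\bigcap_i (X i @^-1` B1 i)) `*` (\bigcap_i (X' i @^-1` B2 i))); last first.
    apply/seteqP; split=> [[x y] /= xyB|[x y] /= [xB yB] i _ /=].
      split=> i _ /=; have /= := xyB i Logic.I; rewrite /B1 /B2;
      by case: (D i).
    have /= := xB i Logic.I; have /= := yB i Logic.I; rewrite /B1 /B2.
    by case: (D i).
  transitivity (P (\bigcap_i (X i @^-1` B1 i)) * P' (\bigcap_i (X' i @^-1` B2 i)))%E.
    apply: product_measure1E; apply: fin_bigcap_measurable;
      by [exact: finite_finset|move=> i _; exact: measurable_preimT].
  rewrite iX// iX'// -big_split/=; apply: eq_bigr => i _.
  rewrite law// /B1 /B2; case: (D i); rewrite preimage_setT probability_setT.
    by rewrite mule1.
  by rewrite mul1e.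
- case: (D i).
    exact: measurableT_comp (mX i) measurable_fst.
  exact: measurableT_comp (mX' i) measurable_snd.
- rewrite [LHS]law//; case: (D i); [exact: (nX i).2|exact: (nX' i).2].
Qed.

End families.

(** * Rotation invariance *)

Section affine_substitution.
Context (R : realType).
Notation mu := (@lebesgue_measure R).
Local Open Scope ereal_scope.

Lemma measurable_affine (a b : R) : measurable_fun setT (fun x : R => a * x + b)%R.
Proof. by apply: measurable_funD => //; exact: measurable_funM. Qed.

Lemma lebesgue_measure_affine (a b : R) (A : set R) : a != 0%R -> measurable A ->
  `|a|%:E * mu ((fun x => a * x + b)%R @^-1` A) = mu A.
Proof.
move=> a0 mA.
pose phi : measurableTypeR R -> measurableTypeR R := fun x => (a * x + b)%R.
have mphi : measurable_fun setT phi by exact: measurable_affine.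
apply/esym; apply: (@lebesgue_measure_unique R
  (mscale (`|a|%:nng)%R (pushforward mu phi))) => //= _ [[x y]] _ <-.
rewrite /mscale /pushforward/=.
have [ap|] := ltP 0%R a; last rewrite le_eqVlt (negbTE a0) /= => an.
  rewrite [X in (_ * mu X)%E](_ : _ = [set` `](x - b) / a, (y - b) / a]%R]); last first.
    apply/seteqP; split=> z /=; rewrite !in_itv/= ?/phi ltr_pdivrMr// ler_pdivlMr//;
    by rewrite ltrBlDr lerBrDr mulrC.
  rewrite !lebesgue_measure_itv/= !lte_fin ltr_pM2r ?invr_gt0// ltrD2r.
  case: ifPn => _; last by rewrite mule0.
  by rewrite -!EFinB -EFinM gtr0_norm//; congr (_%:E); field.
(* A negative slope exchanges the endpoints, so the preimage is closed on the left instead; its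
   length is computed in the same way. *)
rewrite [X in (_ * mu X)%E](_ : _ = [set` `[(y - b) / a, (x - b) / a[%R]); last first.
  apply/seteqP; split=> z /=; rewrite !in_itv/= ?/phi ltr_ndivlMr// ler_ndivrMr//;
  by rewrite ltrBlDr lerBrDr mulrC andbC.
rewrite !lebesgue_measure_itv/= !lte_fin ltr_nM2r ?invr_lt0// ltrD2r.
case: ifPn => _; last by rewrite mule0.
by rewrite -!EFinB -EFinM ltr0_norm//; congr (_%:E); field.
Qed.

Lemma ge0_integral_affine (a b : R) (f : R -> \bar R) : a != 0%R ->
  measurable_fun setT f -> (forall x, 0 <= f x) ->
  `|a|%:E * \int[mu]_x f (a * x + b)%R = \int[mu]_x f x.
Proof.
move=> a0 mf f0.
pose phi : measurableTypeR R -> measurableTypeR R := fun x => (a * x + b)%R.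
have mphi : measurable_fun setT phi by exact: measurable_affine.
have := @ge0_integral_pushforward _ _ _ _ _ _ mphi mu setT f measurableT mf.
rewrite preimage_setT /= => <-; last by move=> x _; exact: f0.
rewrite -(ge0_integral_mscale (pushforward mu phi) measurableT (`|a|%:nng)%R)//=.
apply: (@eq_measure_integral _ _ _ _ mu (mscale (`|a|%:nng)%R (pushforward mu phi))).
by move=> A mA _; exact: lebesgue_measure_affine.
Qed.

End affine_substitution.

Section rotation.
Context (R : realType).
Notation mu := (@lebesgue_measure R).
Local Open Scope ereal_scope.

Lemma measurable_linear2 (a b c e : R) : measurable_fun setT
  (fun z : R * R => (a * z.1 + b * z.2, c * z.1 + e * z.2)%R).
Proof.
apply: measurable_fun_pair; apply: measurable_funD; apply: measurable_funM => //.
Qed.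

(** A rotation with [c != 0] is a composition of two one-variable affine substitutions: first
    [x' = c x - s y] at fixed [y], then [y' = (s/c) x' + y/c] at fixed [x']. Their Jacobians are
    inverse to each other. *)
Lemma ge0_integral_rotation (c s : R) (F : R * R -> \bar R) :
  (c ^+ 2 + s ^+ 2 = 1)%R -> measurable_fun setT F -> (forall z, 0 <= F z) ->
  \int[mu]_x \int[mu]_y F (c * x - s * y, s * x + c * y)%R =
  \int[mu]_x \int[mu]_y F (x, y).
Proof.
move=> cs1 mF F0.
have swap (a b a' b' : R) :
  \int[mu]_x \int[mu]_y F (a * x + b * y, a' * x + b' * y)%R =
  \int[mu]_y \int[mu]_x F (a * x + b * y, a' * x + b' * y)%R.
  apply: (@fubini_tonelli _ _ _ _ _ mu mu
    (fun z => F (a * z.1 + b * z.2, a' * z.1 + b' * z.2)%R)) => //.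
  by apply: measurableT_comp => //; exact: measurable_linear2.
have mF2 (a b a' b' : R) (y : R) :
    measurable_fun setT (fun x => F (a * x + b * y, a' * x + b' * y)%R).
  apply: (measurableT_comp (f:=F)) => //.
  by apply: measurable_fun_pair; exact: measurable_affine.
have mF1 (a b a' b' : R) (x : R) :
    measurable_fun setT (fun y => F (a * x + b * y, a' * x + b' * y)%R).
  apply: (measurableT_comp (f:=F)) => //.
  by apply: measurable_fun_pair; under eq_fun do rewrite addrC; exact: measurable_affine.
have eqJ (G1 G2 : R -> R -> R * R) : (forall x y, G1 x y = G2 x y) ->
    \int[mu]_x \int[mu]_y F (G1 x y) = \int[mu]_x \int[mu]_y F (G2 x y).
  move=> G12; apply: eq_integral => x _; apply: eq_integral => y _.
  by rewrite G12.
(* Without division by [c], the map is an exchange of the variables composed with sign changes, as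
   [|s| = 1]. *)
have [c0|c0] := eqVneq c 0%R.
  have s0 : s != 0%R.
    by apply: contra_eq_neq cs1 => ->; rewrite c0 !expr0n/= addr0 eq_sym oner_eq0.
  have s1 : (`|s| = 1)%R.
    apply/eqP; rewrite -(@eqrXn2 _ 2)// expr1n real_normK ?num_real//.
    by rewrite -cs1 c0 expr0n add0r.
  transitivity (\int[mu]_y \int[mu]_x F (0 * x + - s * y, s * x + 0 * y)%R).
    rewrite -swap; apply: eqJ => x y; congr (_, _); rewrite c0; ring.
  transitivity (\int[mu]_y \int[mu]_x F (0 * x + - s * y, 1 * x + 0 * y)%R).
    apply: eq_integral => y _.
    rewrite -(@ge0_integral_affine _ s 0%R
      (fun x => F (0 * x + - s * y, 1 * x + 0 * y)%R) s0)//.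
    rewrite s1 mul1e; apply: eq_integral => x _.
    congr (F (_, _)); ring.
  rewrite -swap.
  transitivity (\int[mu]_x \int[mu]_y F (0 * x + 1 * y, 1 * x + 0 * y)%R).
    apply: eq_integral => x _.
    rewrite -(@ge0_integral_affine _ (- s)%R 0%R
      (fun y => F (0 * x + 1 * y, 1 * x + 0 * y)%R))// ?oppr_eq0//.
    rewrite normrN s1 mul1e; apply: eq_integral => y _.
    congr (F (_, _)); ring.
  rewrite swap; apply: eqJ => x y; congr (_, _); ring.
transitivity (\int[mu]_y \int[mu]_x F (c * x + - s * y, s * x + c * y)%R).
  by rewrite -swap; apply: eqJ => x y; rewrite mulNr.
transitivity (\int[mu]_y (`|c|^-1%:E * \int[mu]_x F (x, s / c * x + c^-1 * y)%R)).
  apply: eq_integral => y _.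
  rewrite -(@ge0_integral_affine _ c (- (s * y)) (fun x => F (x, s / c * x + c^-1 * y)%R))//.
    rewrite muleA -EFinM mulVf ?normr_eq0// mul1e; apply: eq_integral => x _.
    congr (F (_, _)); first by rewrite mulNr.
    have -> : (s / c * (c * x - s * y) + c^-1 * y = s * x + c^-1 * (1 - s ^+ 2) * y)%R by field.
    by rewrite -cs1 addrK; field.
  have := mF2 1%R 0%R (s / c)%R c^-1%R y.
  by under eq_fun do rewrite mul1r mul0r addr0.
have mG : measurable_fun setT (fun z : R * R => F (z.1, s / c * z.1 + c^-1 * z.2)%R).
  have := measurableT_comp mF (measurable_linear2 1 0 (s / c) c^-1).
  by rewrite /comp; under eq_fun do rewrite mul1r mul0r addr0.
rewrite ge0_integralZl//; last 2 first.
- exact: (@measurable_fun_fubini_tonelli_G _ _ _ _ _ mu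
    (fun z : R * R => F (z.1, s / c * z.1 + c^-1 * z.2)%R) mG (fun=> F0 _)).
- by move=> y _; exact: integral_ge0.
rewrite -(@fubini_tonelli _ _ _ _ _ mu mu
    (fun z : R * R => F (z.1, s / c * z.1 + c^-1 * z.2)%R))//=.
rewrite -ge0_integralZl//; last 2 first.
- exact: (@measurable_fun_fubini_tonelli_F _ _ _ _ _ mu
    (fun z : R * R => F (z.1, s / c * z.1 + c^-1 * z.2)%R) mG (fun=> F0 _)).
- by move=> y _; exact: integral_ge0.
apply: eq_integral => x _.
(* The factor [|c|^-1] left by the first substitution is exactly the Jacobian of this second one. *)
rewrite -(@ge0_integral_affine _ c^-1 (s / c * x) (fun y => F (x, y)))//.
- by rewrite normfV; congr (_ * _); apply: eq_integral => y _; rewrite addrC.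
- by rewrite invr_eq0.
- have := mF1 1%R 0%R 0%R 1%R x.
  by under eq_fun do rewrite !mul1r !mul0r addr0 add0r.
Qed.

End rotation.

(** * Rotation invariance of the planar Gaussian measure *)

Section gaussian_rotation.
Context (R : realType).
Notation mu := (@lebesgue_measure R).
Notation sigma := (Num.sqrt (2^-1) : R).
Notation nu := (normal_prob 0%R sigma).
Local Open Scope ereal_scope.

Lemma normal_pdf_half (x : R) :
  (normal_pdf 0%R sigma x = (Num.sqrt pi)^-1 * expR (- x ^+ 2))%R.
Proof.
have s0 : sigma != 0%R by rewrite gt_eqF// sqrtr_gt0 invr_gt0.
rewrite normal_pdfE// /normal_peak /normal_fun subr0.
have -> : (sigma ^+ 2 *+ 2 = 1)%R.
  by rewrite sqr_sqrtr ?invr_ge0// -mulr_natr mulVf// pnatr_eq0.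
by rewrite -mulrnAl sqr_sqrtr ?invr_ge0// -mulr_natr mulVf ?pnatr_eq0// mul1r divr1.
Qed.

Lemma ge0_integral_normal (f : R -> \bar R) :
  measurable_fun setT f -> (forall x, 0 <= f x) ->
  \int[nu]_x f x = \int[mu]_x (f x * (normal_pdf 0%R sigma x)%:E).
Proof.
move=> mf f0; apply: (@ge0_integral_density _ _ _ mu nu) => //.
- exact: measurable_normal_pdf.
- by move=> x; exact: normal_pdf_ge0.
Qed.

Lemma ge0_integral_normal2 (F : R * R -> \bar R) :
  measurable_fun setT F -> (forall z, 0 <= F z) ->
  \int[nu]_x \int[nu]_y F (x, y) =
  \int[mu]_x \int[mu]_y
    (F (x, y) * (normal_pdf 0%R sigma x * normal_pdf 0%R sigma y)%:E).
Proof.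
move=> mF F0.
rewrite ge0_integral_normal; last 2 first.
- exact: (@measurable_fun_fubini_tonelli_F _ _ _ _ _ nu F mF F0).
- by move=> x; exact: integral_ge0.
apply: eq_integral => x _.
have mFx : measurable_fun setT (fun y => F (x, y)).
  by apply: (measurableT_comp (f:=F)) => //; exact: measurable_fun_pair.
rewrite ge0_integral_normal// -ge0_integralZr//.
- by apply: eq_integral => y _; rewrite -muleA -EFinM mulrC.
- apply: emeasurable_funM => //.
  by apply/measurable_EFinP; exact: measurable_normal_pdf.
- by move=> y _; rewrite mule_ge0// lee_fin normal_pdf_ge0.
- by rewrite lee_fin normal_pdf_ge0.
Qed.

Lemma normal_rotation (c s : R) (E : set (R * R)) :
  (c ^+ 2 + s ^+ 2 = 1)%R -> measurable E ->
  (nu \x nu) ((fun z => (c * z.1 - s * z.2, s * z.1 + c * z.2)%R) @^-1` E) =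
  (nu \x nu) E.
Proof.
move=> cs1 mE; set rot := fun z => _.
have mrot : measurable_fun setT rot.
  have := @measurable_linear2 R c (- s) s c.
  by under eq_fun do rewrite mulNr.
have mE' : measurable (rot @^-1` E) by exact: measurable_preimT.
have mI (A : set (R * R)) : measurable A ->
    measurable_fun setT (fun z => (\1_A z)%:E : \bar R).
  by move=> mA; apply/measurable_EFinP; exact: measurable_indic.
have E0 (A : set (R * R)) z : 0 <= ((\1_A z)%:E : \bar R) by rewrite lee_fin.
pose g (x : R) := normal_pdf 0%R sigma x.
have measE (A : set (R * R)) : measurable A -> (nu \x nu) A =
    \int[mu]_x \int[mu]_y ((\1_A (x, y))%:E * (g x * g y)%:E).
  move=> mA; rewrite -[A in LHS]setIT -integral_indic//.
  rewrite fubini_tonelli1//; last exact: mI.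
  exact: (@ge0_integral_normal2 (fun z => (\1_A z)%:E) (mI A mA) (E0 A)).
rewrite (measE _ mE') (measE _ mE).
have rotE := @ge0_integral_rotation R c s
  (fun z => (\1_E z)%:E * (g z.1 * g z.2)%:E) cs1.
transitivity (\int[mu]_x \int[mu]_y
  (fun z => (\1_E z)%:E * (g z.1 * g z.2)%:E) (c * x - s * y, s * x + c * y)%R);
  last apply: rotE.
- apply: eq_integral => x _; apply: eq_integral => y _ /=.
  congr (_ * _%:E); rewrite /g !normal_pdf_half.
  rewrite mulrACA -expRD [in RHS]mulrACA -expRD; congr (_ * expR _)%R.
  (* The product density is a function of [x^2 + y^2] alone, which the rotation preserves. *)
  transitivity (- (c ^+ 2 + s ^+ 2) * (x ^+ 2 + y ^+ 2))%R; last by ring.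
  by rewrite cs1; ring.
- apply: emeasurable_funM; first exact: mI.
  apply/measurable_EFinP/measurable_funM; apply: measurableT_comp => //;
    exact: measurable_normal_pdf.
- move=> z; rewrite mule_ge0// lee_fin mulr_ge0 ?normal_pdf_ge0//.
Qed.

End gaussian_rotation.

(** * Rotating two coordinates of an independent Gaussian family *)

Section family_rotation.
Context (R : realType) (I : finType).
Notation family := (g_sigma_algebraType (@cylinders R I)).
Notation nu := (normal_prob 0 (Num.sqrt (2^-1) : R)).

Definition rotate_family (a b : I) (c s : R) (x : I -> R) (i : I) : R :=
  if i == a then c * x a - s * x b else
  if i == b then s * x a + c * x b else x i.

Lemma gaussian_pair d (Omega : measurableType d) (P : probability Omega R)
    (X : I -> Omega -> R) (a b : I) (E : set (R * R)) :
  gaussian_family P X -> a != b -> measurable E ->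
  P [set w | E (X a w, X b w)] = (nu \x nu)%E E.
Proof.
move=> [iX nX] ab mE.
pose T := measurableTypeR R.
pose Y : Omega -> (T * T)%type := fun w => (X a w, X b w).
have mXT i : @measurable_fun _ _ Omega T setT (X i) by exact: (nX i).1.
have mY : measurable_fun setT Y by exact: measurable_fun_pair.
have mE' : @measurable _ (T * T)%type E by exact: mE.
apply/esym; apply: (@product_measure_unique _ _ _ _ R nu nu
  (measure_function_pushforward__canonical__measure_function_Measure P mY) _ _ mE').
move=> A B mA mB; rewrite /pushforward /=.
pose C i := if i == a then A else if i == b then B else setT.
have mC i : measurable (C i) by rewrite /C; case: ifP => // _; case: ifP.
have := iX C mC.
rewrite (_ : \bigcap_i _ = Y @^-1` (A `*` B)).
  move=> XE; apply: (etrans XE); rewrite (bigD1 a)//= (bigD1 b)/=; last by rewrite eq_sym.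
  rewrite big1 ?mule1 => [|i /andP[/negPf ia /negPf ib]].
    by rewrite /C eqxx (nX a).2// eq_sym (negPf ab) eqxx (nX b).2.
  by rewrite /C ia ib preimage_setT probability_setT.
apply/seteqP; split=> w /= => [wC|[wA wB] i _ /=].
  have /= := wC a Logic.I; have /= := wC b Logic.I.
  by rewrite /C !eqxx eq_sym (negPf ab).
by rewrite /C; case: eqP => [->//|_]; case: eqP => [->//|_].
Qed.

Lemma gaussian_family_rotation d (Omega : measurableType d)
    (P : probability Omega R) (X : I -> Omega -> R) (a b : I) (c s : R) :
  a != b -> c ^+ 2 + s ^+ 2 = 1 -> gaussian_family P X ->
  gaussian_family P (fun i w => rotate_family a b c s (X ^~ w) i).
Proof.
move=> ab cs1 gX; have [iX nX] := gX.
have mX i := (nX i).1.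
have pairE (A B : set R) : measurable A -> measurable B ->
    P [set w | A (c * X a w - s * X b w) /\ B (s * X a w + c * X b w)] =
    (nu A * nu B)%E.
  move=> mA mB.
  have mAB : measurable (A `*` B) by exact: measurableX.
  pose rot (z : R * R) := (c * z.1 - s * z.2, s * z.1 + c * z.2).
  have mrot : measurable_fun setT rot.
    have := @measurable_linear2 R c (- s) s c.
    by under eq_fun do rewrite mulNr.
  have := @gaussian_pair _ _ P X a b (rot @^-1` (A `*` B)) gX ab
    (measurable_preimT mrot mAB).
  rewrite normal_rotation// product_measure1E// => <-; congr (P _).
have nY i : has_normal_law P (fun w => rotate_family a b c s (X ^~ w) i) 0 (Num.sqrt 2^-1).
  split=> [|A mA]; rewrite /rotate_family.
    case: (i == a); first by apply: measurable_funB; apply: measurable_funM.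
    case: (i == b) => //; by apply: measurable_funD; apply: measurable_funM.
  have nuT : nu setT = 1%E by exact: probability_setT.
  case: (i == a); [|case: (i == b)]; last exact: (nX i).2.
    have := pairE A setT mA measurableT; rewrite nuT mule1 => <-; congr (P _).
    by apply/seteqP; split=> w //= [].
  have := pairE setT A measurableT mA; rewrite nuT mul1e => <-; congr (P _).
  by apply/seteqP; split=> w //= [].
split=> // B mB.
pose D (i : I) := (i != a) && (i != b).
pose C : set family := [set x | forall i, B i (rotate_family a b c s x i)].
have mC : measurable C.
  rewrite (_ : C = \bigcap_i [set x | B i (rotate_family a b c s x i)]); last first.
    by apply/seteqP; split=> x Cx i; [move=> _|]; exact: Cx.
  apply: fin_bigcap_measurable; first exact: finite_finset.
  move=> i _; apply: (@measurable_preimT _ family _ _ (fun x => rotate_family a b c s x i)) => //.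
  rewrite /rotate_family.
  case: (i == a).
    by apply: measurable_funB; apply: measurable_funM => //; exact: measurable_coord.
  case: (i == b); last exact: measurable_coord.
  by apply: measurable_funD; apply: measurable_funM => //; exact: measurable_coord.
transitivity (P [set w | C (fun i => X i w)]).
  by congr (P _); apply/seteqP; split=> w Cw i; [|move=> _]; exact: Cw.
(* The untouched coordinates and the rotated pair go to separate copies of [Omega], where the event
   becomes a rectangle: this is the independence of the new pair from the rest. *)
rewrite (gaussian_family_event gX (gaussian_family_split D gX gX))//.
pose B' i := if D i then B i else setT.
have mB' i : measurable (B' i) by rewrite /B'; case: ifP.
pose Erot : set Omega :=
  [set w | B a (c * X a w - s * X b w) /\ B b (s * X a w + c * X b w)].
transitivity ((P \x P)%E ((\bigcap_i (X i @^-1` B' i)) `*` Erot)).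
  congr ((P \x P)%E _); apply/seteqP.
  have Da : D a = false by rewrite /D eqxx.
  have Db : D b = false by rewrite /D eqxx andbF.
  split=> [[w1 w2] /= Cw|[w1 w2] /= [w1B [Ba Bb]] i].
    split=> [i _ /=|].
      have := Cw i; rewrite /B' /rotate_family.
      case Di : (D i) => //; move: Di; rewrite /D.
      by case: (i == a) => //; case: (i == b).
    have := Cw a; have := Cw b.
    by rewrite /rotate_family !eqxx eq_sym (negPf ab) Da Db.
  rewrite /rotate_family; case: eqP => [->|/eqP ia]; first by rewrite Da Db.
  case: eqP => [->|/eqP ib]; first by rewrite Da Db.
  by have /= := w1B i Logic.I; rewrite /B' /D ia ib.
transitivity (P (\bigcap_i (X i @^-1` B' i)) * P Erot)%E.
  apply: product_measure1E.
    apply: fin_bigcap_measurable; first exact: finite_finset.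
    by move=> i _; exact: measurable_preimT.
  apply: measurableI; apply: (@measurable_preimT _ _ _ _ (fun w => _)) => //.
    by apply: measurable_funB; apply: measurable_funM.
  by apply: measurable_funD; apply: measurable_funM.
rewrite /Erot pairE// iX// (bigD1 a)//= (bigD1 b)/=; last by rewrite eq_sym.
rewrite [in RHS](bigD1 a)//= [in RHS](bigD1 b)/=; last by rewrite eq_sym.
rewrite !(nY _).2// {1 2}/B' /D !eqxx/= andbF !preimage_setT !probability_setT !mul1e.
rewrite muleC -muleA; congr (_ * (_ * _))%E; apply: eq_bigr => i /andP[ia ib].
by rewrite /B' /D ia ib (nX i).2// (nY i).2.
Qed.

End family_rotation.

(** * The Euler constant and elementary integrals *)

Section euler_gamma.
Context (R : realType).

Definition Hsum (n : nat) : R := \sum_(1 <= k < n.+1) k%:R^-1.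

Lemma HsumS n : Hsum n.+1 = Hsum n + n.+1%:R^-1.
Proof. by rewrite /Hsum big_nat_recr. Qed.

Lemma ln_step_le (n : nat) : (0 < n)%N ->
  ln (n.+1%:R : R) - ln n%:R <= n%:R^-1.
Proof.
move=> n0; have n0' : (0 : R) < n%:R by rewrite ltr0n.
rewrite -ln_div ?posrE ?ltr0n//.
have -> : n.+1%:R / n%:R = 1 + n%:R^-1 :> R by rewrite -natr1; field; rewrite gt_eqF.
by apply: le_ln1Dx; rewrite (lt_trans (ltrN10 R)) ?invr_gt0.
Qed.

Lemma ln_step_ge (n : nat) : (0 < n)%N ->
  n.+1%:R^-1 <= ln (n.+1%:R : R) - ln n%:R.
Proof.
move=> n0; have n0' : (0 : R) < n%:R by rewrite ltr0n.
have n1 : (0 : R) < n.+1%:R by rewrite ltr0n.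
rewrite -lerN2 opprB -ln_div ?posrE//.
have -> : n%:R / n.+1%:R = 1 + - n.+1%:R^-1 :> R.
  by rewrite -natr1; field; rewrite natr1 gt_eqF.
apply: le_ln1Dx; rewrite ltrN2 invf_lt1// ltr1n ltnS//.
Qed.

(** [euler_gamma] is defined by [limn], so convergence has to be established before its value can be
    used. The sequence decreases and is bounded below, by the two estimates of [ln (n+1) - ln n]. *)
Lemma cvg_euler_gamma :
  (fun n : nat => Hsum n - ln (n%:R : R)) @ \oo --> (euler_gamma : R).
Proof.
suff : cvgn (fun n : nat => Hsum n - ln (n%:R : R)) by [].
(* The shift avoids the index 0, where [ln 0 = 0] gives the value 0, below the value 1 at index
   1. *)
pose v n := Hsum n.+1 - ln (n.+1%:R : R).
suff cv : cvgn v by apply/cvg_ex; exists (limn v); rewrite -cvg_shiftS.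
apply: nonincreasing_is_cvgn.
  apply/nonincreasing_seqP => n; rewrite /v HsumS lerBlDr -!addrA lerD2l addrC.
  exact: ln_step_ge.
exists 0 => _ [n _ <-]; rewrite /v subr_ge0.
have ln_le m : ln (m.+1%:R : R) <= Hsum m.
  elim: m => [|m IH]; first by rewrite ln1 /Hsum big_geq.
  by rewrite HsumS -[leLHS](subrK (ln m.+1%:R)) addrC lerD// ln_step_le.
by rewrite HsumS (le_trans (ln_le n))// lerDl invr_ge0.
Qed.

(** The hypothesis has the shape produced after adding finitely many exponential variables. As [N]
    grows, [H_N - ln N] tends to gamma and [1/N] to 0; replacing [ln (N+1)] by [ln N] only lowers
    the left side. *)
Lemma euler_gamma_bound (x : \bar R) (c p h : R) (N0 : nat) : 0 <= p ->
  (forall N, (0 < N)%N -> (N0 <= N)%N ->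
     ((c + p * (h - Hsum N + ln N.+1%:R - N%:R^-1))%:E <= x)%E) ->
  ((c + p * (h - euler_gamma))%:E <= x)%E.
Proof.
case: x => [x| |] p0 H; last 2 first.
- by rewrite leey.
- by have := H N0.+1 isT (leqnSn _); rewrite leNgt ltNyr.
rewrite lee_fin.
have cvg1 : (fun n : nat => n.+1%:R^-1 : R) @ \oo --> (0 : R) by exact: cvg_harmonic.
have cvg2 : (fun n : nat => n%:R^-1 : R) @ \oo --> (0 : R) by rewrite -cvg_shiftS.
have cvgB : (fun N : nat => c + p * (h - (Hsum N - ln (N%:R : R)) - N%:R^-1)) @ \oo -->
    c + p * (h - euler_gamma - 0).
  apply: cvgD; first exact: cvg_cst.
  apply: cvgM; first exact: cvg_cst.
  apply: cvgB => //; apply: cvgB; first exact: cvg_cst.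
  exact: cvg_euler_gamma.
rewrite subr0 in cvgB.
apply: (cvgr_to_le cvgB); near=> N.
have N0' : (0 < N)%N by near: N; exact: nbhs_infty_gt.
have NN0 : (N0 <= N)%N by near: N; exact: nbhs_infty_ge.
have := H N N0' NN0; rewrite lee_fin; apply: le_trans.
rewrite lerD2l ler_wpM2l// lerB// opprB addrCA [leRHS]addrC lerD2r.
by rewrite ler_ln ?posrE ?ltr0n// ler_nat.
Unshelve. all: by end_near. Qed.

End euler_gamma.

(** * Two integrals over the half-line *)

Section integrals.
Context (R : realType).
Notation mu := (@lebesgue_measure R).
Local Open Scope ereal_scope.

Lemma integral_expR_pos (a : R) : (0 < a)%R ->
  \int[mu]_(t in `]0%R, +oo[) (expR (- (t * a)))%:E = a^-1%:E.
Proof.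
move=> a0.
have mE : measurable_fun setT (fun t : R => (expR (- (t * a)))%:E).
  apply/measurable_EFinP; apply: measurableT_comp => //.
  by apply: measurableT_comp => //; exact: measurable_funM.
rewrite integral_itv_obnd_cbnd; last exact: measurable_funTS.
rewrite -[RHS]mule1 -(integral_exponential_pdf a0) -ge0_integralZl//; last 3 first.
- by apply/measurable_EFinP; exact: measurable_exponential_pdf.
- by move=> x _; rewrite lee_fin exponential_pdf_ge0// ltW.
- by rewrite lee_fin invr_ge0 ltW.
rewrite [LHS]integral_mkcond; apply: eq_integral => x _.
rewrite /exponential_pdf !patchE; case: ifPn => _; last by rewrite mule0.
by rewrite -EFinM mulrA mulVf ?gt_eqF// mul1r mulNr mulrC.
Qed.

Lemma integral_inv_pow (k : nat) :
  \int[mu]_(t in `]0%R, +oo[) ((1 + t) ^- k.+2)%:E = (k.+1%:R^-1)%:E.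
Proof.
(* The absolute value removes the pole at -1, which makes the integrand continuous, hence
   measurable, on the whole line. *)
pose f (t : R) := ((1 + `|t|) ^- k.+2)%R.
pose F : R -> R := (- k.+1%:R^-1)%R \*: ((fun t : R => (1 + t)^-1)%R ^+ k.+1)%R.
transitivity (\int[mu]_(t in `]0%R, +oo[) (f t)%:E).
  apply: eq_integral => t; rewrite inE/= in_itv/= andbT => t0.
  by rewrite /f ger0_norm// ltW.
have cf : continuous f.
  move=> x; apply: cvgV; first by rewrite expf_neq0// gt_eqF// ltr_pwDl.
  apply: (@continuous_comp _ _ _ (fun t : R => 1 + `|t|)%R (fun y => y ^+ k.+2)%R).
    by apply: cvgD; [exact: cvg_cst|exact: norm_continuous].
  exact: exprn_continuous.
have mf : measurable_fun setT (fun t => (f t)%:E).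
  by apply/measurable_EFinP; exact: continuous_measurable_fun.
rewrite integral_itv_obnd_cbnd; last exact: measurable_funTS.
have dF (x : R) : (0 <= x)%R -> is_derive x 1%R F ((1 + x) ^- k.+2)%R.
  move=> x0; have x1 : (1 + x != 0)%R by rewrite gt_eqF// ltr_pwDl.
  have d1 : is_derive x 1%R (fun t : R => (1 + t)%R) 1%R.
    by rewrite -[X in is_derive _ _ _ X]add0r; exact: is_deriveD.
  have dV := is_deriveV x1 d1.
  have dZ := is_deriveZ (- k.+1%:R^-1)%R (is_deriveX k.+1 dV).
  apply: (is_derive_eq dZ); rewrite /= /GRing.scale/= mulr1 -!exprVn.
  rewrite [LHS](_ : _ = (k.+1%:R^-1 * k.+1%:R) * ((1 + x)^-1 ^+ k * (1 + x)^-1 ^+ 2))%R;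
    last by ring.
  by rewrite mulVf ?pnatr_eq0// mul1r -exprD addn2.
rewrite (@ge0_continuous_FTC2y _ f F 0%R 0%R).
- by rewrite /F /= exprfctE /GRing.scale/= addr0 invr1 expr1n mulr1 -EFinB sub0r opprK.
- by move=> x _; rewrite /f invr_ge0 exprn_ge0// addr_ge0.
- exact: continuous_subspaceT.
- rewrite -[X in _ --> X](mulr0 (- k.+1%:R^-1)%R).
  rewrite (_ : F = fun t : R => (- k.+1%:R^-1 * (1 + t)^-1 ^+ k.+1)%R); last first.
    by apply/funext => t; rewrite /F /= exprfctE.
  apply: cvgM; first exact: cvg_cst.
  rewrite -[X in _ --> X](expr0n R k.+1).
  apply: (@continuous_cvg _ _ _ _ _ (fun t : R => (1 + t)^-1)%R (fun y : R => y ^+ k.+1)%R).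
    exact: exprn_continuous.
  apply/gtr0_cvgV0; last exact: cvg_addrl.
  by near=> t; rewrite ltr_wpDl// ltW.
- by move=> x x0; have [] := dF x (ltW x0).
- apply: cvg_at_right_filter.
  have [d0 _] := dF 0%R (lexx _).
  exact/differentiable_continuous/derivable1_diffP.
- move=> x; rewrite in_itv/= andbT => x0.
  have [d0 dE] := dF x (ltW x0).
  by rewrite derive1E dE /f ger0_norm// ltW.
Unshelve. all: by end_near. Qed.

End integrals.

(** * Variables with a Gamma Laplace transform *)

Section tonelli.
Context (R : realType) d1 (T1 : measurableType d1) d2 (T2 : measurableType d2).
Variables (m1 : {sigma_finite_measure set T1 -> \bar R})
  (m2 : {sigma_finite_measure set T2 -> \bar R}).
Local Open Scope ereal_scope.

Lemma tonelli_on (D1 : set T1) (D2 : set T2) (g : T1 * T2 -> \bar R) :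
  measurable D1 -> measurable D2 ->
  measurable_fun setT g -> (forall z, 0 <= g z) ->
  \int[m1]_(x in D1) \int[m2]_(y in D2) g (x, y) =
  \int[m2]_(y in D2) \int[m1]_(x in D1) g (x, y).
Proof.
move=> mD1 mD2 mg g0.
pose G (z : T1 * T2) := g z * (\1_D1 z.1)%:E * (\1_D2 z.2)%:E.
have mG : measurable_fun setT G.
  apply: emeasurable_funM; [apply: emeasurable_funM => //|];
    apply/measurable_EFinP; apply: measurableT_comp => //;
    exact: measurable_indic.
have G0 z : 0 <= G z by rewrite !mule_ge0// lee_fin.
have := fubini_tonelli (m1 := m1) (m2 := m2) G mG G0.
rewrite (integral_mkcond D1) (integral_mkcond D2).
congr (_ = _); apply: eq_integral => x _; rewrite patchE.
- case: ifPn => [xD|xD]; last first.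
    by rewrite integral0_eq// => y _; rewrite /G/= indicE (negPf xD) mule0 mul0e.
  rewrite [RHS]integral_mkcond; apply: eq_integral => y _.
  rewrite patchE /G/= !indicE xD mule1.
  by case: ifPn => _; rewrite ?mule1 ?mule0.
- case: ifPn => [xD|xD]; last first.
    by rewrite integral0_eq// => y _; rewrite /G/= [\1_D2 _]indicE (negPf xD) mule0.
  rewrite [RHS]integral_mkcond; apply: eq_integral => y _.
  rewrite patchE /G/= !indicE xD mule1.
  by case: ifPn => _; rewrite ?mule1 ?mule0.
Qed.

End tonelli.
Arguments tonelli_on {R d1 T1 d2 T2} m1 m2 {D1 D2} g.

Section frullani.
Context (R : realType).
Notation mu := (@lebesgue_measure R).
Local Open Scope ereal_scope.

(** The integrand equals the integral of [exp (- t x)] for [x] from [a] to [b]. Exchanging the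
    integrals leaves that of [1/x]. *)
Lemma frullani (a b : R) : (0 < a)%R -> (a < b)%R ->
  \int[mu]_(t in `]0%R, +oo[) ((expR (- (t * a)) - expR (- (t * b))) / t)%:E =
  (ln b - ln a)%:E.
Proof.
move=> a0 ab.
have mE : measurable_fun setT (fun z : R * R => (expR (- (z.1 * z.2)))%:E).
  apply/measurable_EFinP; apply: measurableT_comp => //.
  by apply: measurableT_comp => //; exact: measurable_funM.
transitivity (\int[mu]_(t in `]0%R, +oo[) \int[mu]_(x in `[a, b]) (expR (- (t * x)))%:E).
  apply: eq_integral => t; rewrite inE/= in_itv/= andbT => t0.
  have dF (x : R) : is_derive x 1%R (fun y : R => (- t^-1 * expR (- (t * y)))%R)
      (expR (- (t * x))).
    have d1 : is_derive x 1%R (fun y : R => (- (t * y))%R) (- t)%R.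
      rewrite -[X in is_derive _ _ _ X](_ : - (t *: 1) = - t)%R; last by rewrite /GRing.scale/= mulr1.
      by apply: is_deriveN; exact: is_deriveZ.
    have d2 := is_deriveZ (- t^-1)%R (@is_derive1_comp R expR
      (fun y : R => (- (t * y))%R) x _ _ (is_derive_expR (- (t * x))%R) d1).
    apply: (is_derive_eq d2); rewrite /GRing.scale/= mulrN mulrNN mulrC -mulrA.
    by rewrite divff ?mulr1// gt_eqF.
  have cF : continuous (fun y : R => (- t^-1 * expR (- (t * y)))%R).
    move=> x; have [d _] := dF x.
    exact/differentiable_continuous/derivable1_diffP.
  rewrite (@continuous_FTC2 _ _ (fun y : R => (- t^-1 * expR (- (t * y)))%R))//.
  - by rewrite -EFinB; congr (_%:E); ring.
  - apply: continuous_subspaceT => x.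
    apply: (@continuous_comp _ _ _ (fun y : R => (- (t * y))%R) expR); last exact: continuous_expR.
    by apply: cvgN; apply: cvgM; [exact: cvg_cst|exact: cvg_id].
  - split.
    + by move=> x _; have [] := dF x.
    + exact/cvg_at_right_filter/cF.
    + exact/cvg_at_left_filter/cF.
  - by move=> x _; rewrite derive1E; have [] := dF x.
rewrite (tonelli_on mu mu (fun z => (expR (- (z.1 * z.2)))%:E))//=.
transitivity (\int[mu]_(x in `[a, b]) (x^-1)%:E).
  apply: eq_integral => x; rewrite inE/= in_itv/= => /andP[ax _].
  by rewrite integral_expR_pos// (lt_le_trans a0).
have dL (x : R) : (a <= x)%R -> is_derive x 1%R (@ln R) (x^-1)%R.
  by move=> ax; apply: is_derive1_ln; exact: lt_le_trans ax.
have cL (x : R) : (a <= x)%R -> {for x, continuous (@ln R)}.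
  by move=> ax; apply: continuous_ln; exact: lt_le_trans ax.
rewrite (@continuous_FTC2 _ _ (@ln R))//.
- apply: continuous_in_subspaceT => x; rewrite inE/= in_itv/= => /andP[ax _].
  by apply: cvgV; [rewrite gt_eqF// (lt_le_trans a0)|exact: cvg_id].
- split.
  + by move=> x; rewrite in_itv/= => /andP[ax _]; have [] := dL x (ltW ax).
  + exact/cvg_at_right_filter/cL.
  + exact/cvg_at_left_filter/cL/ltW.
- by move=> x; rewrite in_itv/= => /andP[ax _]; rewrite derive1E; have [] := dL x (ltW ax).
Qed.

End frullani.

Section gamma.
Context (R : realType).

Lemma expRNln (x : R) : 0 < x -> expR (- ln x) = x^-1.
Proof. by move=> x0; rewrite expRN lnK. Qed.

Notation mu := (@lebesgue_measure R).
Local Open Scope ereal_scope.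

(* The Laplace transform of the Gamma law with shape [k] and scale 1. *)
Definition gamma_variable d (Omega : measurableType d) (P : probability Omega R)
    (S : Omega -> R) (k : nat) : Prop :=
  [/\ measurable_fun setT S, forall w, (0 < S w)%R &
      forall t, (0 <= t)%R ->
        \int[P]_w (expR (- (t * S w)))%:E = ((1 + t) ^- k)%:E].

Lemma measurable_expR_mul d (Omega : measurableType d) (S : Omega -> R) :
  measurable_fun setT S ->
  measurable_fun setT (fun z : Omega * R => expR (- (z.2 * S z.1))).
Proof.
move=> mS; apply: measurableT_comp => //; apply: measurableT_comp => //.
by apply: measurable_funM => //; exact: measurableT_comp.
Qed.

(** Write [1/S] as the integral of [exp (- t S)] over [t > 0] and exchange: only the Laplace
    transform remains. Shape at least 2 makes the result finite. *)
Lemma gamma_inv_expectation d (Omega : measurableType d) (P : probability Omega R)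
    (S : Omega -> R) (k : nat) : gamma_variable P S k.+2 ->
  \int[P]_w ((S w)^-1)%:E = (k.+1%:R^-1)%:E.
Proof.
move=> [mS S0 LS].
transitivity (\int[P]_w \int[mu]_(t in `]0%R, +oo[) (expR (- (t * S w)))%:E).
  by apply: eq_integral => w _; rewrite integral_expR_pos.
rewrite (tonelli_on P mu (fun z => (expR (- (z.2 * S z.1)))%:E))//=; last first.
  by apply/measurable_EFinP; exact: measurable_expR_mul.
rewrite -integral_inv_pow; apply: eq_integral => t; rewrite inE/= in_itv/= andbT => t0.
by rewrite LS// ltW.
Qed.

(** By Frullani's formula the difference of logarithms is an integral of differences of Laplace
    kernels, so the two transforms determine its expectation. The pointwise order [S <= S'] makes
    the integrand non-negative, as Tonelli's theorem requires. *)
Lemma gamma_ln_step d (Omega : measurableType d) (P : probability Omega R)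
    (S S' : Omega -> R) (k : nat) :
  gamma_variable P S k.+1 -> gamma_variable P S' k.+2 ->
  (forall w, (S w <= S' w)%R) ->
  \int[P]_w (ln (S' w) - ln (S w))%:E = (k.+1%:R^-1)%:E.
Proof.
move=> [mS S0 LS] [mS' S0' LS'] SS'.
pose g (z : Omega * R) := (expR (- (z.2 * S z.1)) - expR (- (z.2 * S' z.1)))%R.
have mg : measurable_fun setT g.
  by apply: measurable_funB; exact: measurable_expR_mul.
have g0 w (t : R) : (0 < t)%R -> (0 <= g (w, t))%R.
  by move=> t0; rewrite /g/= subr_ge0 ler_expR lerN2 ler_pM2l.
(* For [t > 0] this is [g (w, t) / t]; in this form it is also non-negative and measurable on the
   whole product, as [tonelli_on] demands. *)
transitivity (\int[P]_w \int[mu]_(t in `]0%R, +oo[) (`|g (w, t) * expR (- ln t)|)%:E).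
  apply: eq_integral => w _.
  transitivity (\int[mu]_(t in `]0%R, +oo[) (g (w, t) / t)%:E); last first.
    apply: eq_integral => t; rewrite inE/= in_itv/= andbT => t0.
    by rewrite expRNln// ger0_norm// divr_ge0 ?g0// ltW.
  have [E|neq] := eqVneq (S w) (S' w).
    by rewrite E subrr integral0_eq// => t _; rewrite /g/= E subrr mul0r.
  have ltSS' : (S w < S' w)%R by rewrite lt_neqAle neq SS'.
  by rewrite -(frullani (S0 w) ltSS'); apply: eq_integral.
rewrite (tonelli_on P mu (fun z => (`|g z * expR (- ln z.2)|)%:E))//=; last first.
  apply/measurable_EFinP; apply: measurableT_comp => //.
  apply: measurable_funM => //; apply: (measurableT_comp (f:=@expR R)) => //.
  apply: (measurableT_comp (f:=-%R : R -> R)) => //.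
  exact: (measurableT_comp (@measurable_ln R) measurable_snd).
rewrite -integral_inv_pow; apply: eq_integral => t; rewrite inE/= in_itv/= andbT => t0.
have tE : \int[P]_w (g (w, t))%:E + ((1 + t) ^- k.+2)%:E = ((1 + t) ^- k.+1)%:E.
  have mSt (U : Omega -> R) : measurable_fun setT U ->
      measurable_fun setT (fun w => (expR (- (t * U w)))%:E).
    move=> mU; apply/measurable_EFinP; apply: measurableT_comp => //.
    by apply: measurableT_comp => //; exact: measurable_funM.
  rewrite -LS' ?ltW// -LS ?ltW// -ge0_integralD//.
  - by apply: eq_integral => w _; rewrite -EFinD /g/= subrK.
  - by move=> w _; rewrite lee_fin g0.
  - apply/measurable_EFinP; apply: measurable_funB; apply/measurable_EFinP; exact: mSt.
  - exact: mSt.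
transitivity (t^-1%:E * \int[P]_w (g (w, t))%:E).
  rewrite -ge0_integralZl//.
  - apply: eq_integral => w _; rewrite -EFinM; congr (_%:E).
    by rewrite expRNln// ger0_norm ?divr_ge0 ?g0 ?(ltW t0)// mulrC.
  - by apply/measurable_EFinP; apply: (measurableT_comp mg); exact: measurable_pair2.
  - by move=> w _; rewrite lee_fin g0.
  - by rewrite lee_fin invr_ge0 ltW.
have -> : \int[P]_w (g (w, t))%:E = ((1 + t) ^- k.+1 - (1 + t) ^- k.+2)%:E.
  by rewrite EFinB -tE addeK.
have t1 : (1 + t != 0)%R by rewrite gt_eqF// ltr_pwDl// ltW.
rewrite -EFinM; congr (_%:E).
rewrite -!exprVn !exprS.
move: ((1 + t)^-1 ^+ k)%R => x; field.
by rewrite t1 gt_eqF.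
Qed.

End gamma.

(** * Lower bound for the expected logarithm of a Gamma variable *)

Section gamma_log.
Context (R : realType).
Notation mu := (@lebesgue_measure R).
Notation T := (measurableTypeR R).
Local Open Scope ereal_scope.

Definition exp1 : probability T R :=
  exponential_distribution_exponential_prob__canonical__probability_measure_Probability
    (@ltr01 R).

Lemma measurable_normT : @measurable_fun _ _ T R setT (fun y : T => `|y|%R).
Proof. exact: (@normr_measurable R setT). Qed.

Lemma measurable_expR_norm (t : R) :
  @measurable_fun _ _ T (\bar R) setT (fun y : T => (expR (- (t * `|y|)))%:E).
Proof.
have : measurable_fun setT (fun y : R => (expR (- (t * `|y|)))%:E : \bar R).
  apply/measurable_EFinP; apply: (measurableT_comp (f:=@expR R)) => //.
  apply: (measurableT_comp (f:=-%R : R -> R)) => //.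
  by apply: measurable_funM => //; exact: normr_measurable.
exact.
Qed.

(** The exponential law lives on the half-line, so the absolute value does not alter the transform.
    It keeps [S + |y|] positive at every sample point, which [gamma_variable] asks for. *)
Lemma exp1_laplace (t : R) : (0 <= t)%R ->
  \int[exp1]_y (expR (- (t * `|y|)))%:E = ((1 + t)^-1)%:E.
Proof.
move=> t0; have t1 : (0 < 1 + t)%R by rewrite ltr_pwDl.
rewrite (@ge0_integral_density _ T R mu exp1 (exponential_pdf 1)).
- transitivity (((1 + t)^-1)%:E * \int[mu]_x (exponential_pdf (1 + t) x)%:E); last first.
    by rewrite integral_exponential_pdf// mule1.
  rewrite -ge0_integralZl; last 4 first.
  + exact: measurableT.
  + by apply/measurable_EFinP; exact: measurable_exponential_pdf.
  + by move=> x _; rewrite lee_fin exponential_pdf_ge0// ltW.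
  + by rewrite lee_fin invr_ge0 ltW.
  apply: eq_integral => x _; rewrite -!EFinM; congr (_%:E).
  rewrite /exponential_pdf !patchE; case: ifPn => [|_]; last by rewrite !mulr0.
  rewrite inE/= in_itv/= andbT => x0; rewrite ger0_norm// mul1r -expRD.
  by rewrite mulrA mulVf ?gt_eqF// mul1r; congr expR; ring.
- exact: measurable_exponential_pdf.
- by move=> x; exact: exponential_pdf_ge0.
- by [].
- exact: measurable_expR_norm.
- by move=> y; rewrite lee_fin expR_ge0.
Qed.

Section product.
Context d (Omega : measurableType d) (P : probability Omega R).

Lemma integral_fst (f : Omega -> \bar R) :
  measurable_fun setT f -> (forall w, 0 <= f w) ->
  \int[P \x exp1]_z f z.1 = \int[P]_w f w.
Proof.
move=> mf f0.
rewrite (@fubini_tonelli1 _ _ _ _ _ P exp1 (fun z => f z.1))//; last first.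
  exact: measurableT_comp.
apply: eq_integral => w _; rewrite /fubini_F/= integral_cst//.
by rewrite [X in _ * X](probability_setT exp1) mule1.
Qed.

Lemma gamma_variable_fst (S : Omega -> R) k :
  gamma_variable P S k -> gamma_variable (P \x exp1) (fun z => S z.1) k.
Proof.
move=> [mS S0 LS]; split=> [| |t t0] //; first exact: measurableT_comp.
rewrite (@integral_fst (fun w => (expR (- (t * S w)))%:E)) ?LS//.
apply/measurable_EFinP; apply: measurableT_comp => //.
by apply: measurableT_comp => //; exact: measurable_funM.
Qed.

(** On the product space the new exponential coordinate is independent of [S], so the transform
    gains one factor [(1 + t)^-1]. *)
Lemma gamma_variableD (S : Omega -> R) k :
  gamma_variable P S k ->
  gamma_variable (P \x exp1) (fun z => S z.1 + `|z.2|)%R k.+1.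
Proof.
move=> [mS S0 LS]; have mY : measurable_fun setT (fun z : Omega * T => `|z.2|%R).
  exact: (measurableT_comp measurable_normT measurable_snd).
have mSY : measurable_fun setT (fun z : Omega * T => S z.1 + `|z.2|)%R.
  by apply: measurable_funD => //; exact: measurableT_comp.
split=> // [z|t t0]; first by rewrite ltr_pwDl.
rewrite (@fubini_tonelli1 _ _ _ _ _ P exp1
  (fun z => (expR (- (t * (S z.1 + `|z.2|))))%:E))//; last first.
  apply/measurable_EFinP; apply: measurableT_comp => //.
  by apply: measurableT_comp => //; exact: measurable_funM.
transitivity (\int[P]_w ((expR (- (t * S w)))%:E * ((1 + t)^-1)%:E)).
  apply: eq_integral => w _; rewrite /fubini_F/= -exp1_laplace// -ge0_integralZl//.
  - by apply: eq_integral => y _; rewrite -EFinM -expRD mulrDr opprD.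
  - exact: measurable_expR_norm.
rewrite ge0_integralZr//; last 2 first.
- apply/measurable_EFinP; apply: measurableT_comp => //.
  by apply: measurableT_comp => //; exact: measurable_funM.
- by rewrite lee_fin invr_ge0 addr_ge0.
by rewrite LS// -EFinM -!exprVn exprSr.
Qed.

End product.

Lemma probability_const_le d (Omega : measurableType d) (P : probability Omega R)
    (x : R) (f : Omega -> \bar R) :
  measurable_fun setT f -> (forall w, 0 <= f w) -> (forall w, x%:E <= f w) ->
  x%:E <= \int[P]_w f w.
Proof.
move=> mf f0 xf; have [x0|x0] := ltP x 0%R.
  apply: (@le_trans _ _ 0); first by rewrite lee_fin ltW.
  exact: integral_ge0.
have -> : x%:E = \int[P]_w (cst x%:E) w.
  by rewrite integral_cst// [X in _ * X](probability_setT P) mule1.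
by apply: ge0_le_integral.
Qed.

(** The bound is stated for a non-negative [f] above [c + p ln S], so that [ln S], which changes
    sign, is never integrated by itself. Each induction step adjoins an exponential coordinate,
    hence the quantification over probability spaces. The condition [0 < j + m] brings the final
    shape to at least 2, where [E (1/S)] is finite. *)
Lemma gamma_ln_bound_finite m : forall d (Omega : measurableType d)
    (P : probability Omega R) (S : Omega -> R) (f : Omega -> \bar R) (c p : R) j,
  (0 <= p)%R -> gamma_variable P S j.+1 -> measurable_fun setT f ->
  (forall w, 0 <= f w) -> (forall w, (c + p * ln (S w))%:E <= f w) -> (0 < j + m)%N ->
  (c + p * (Hsum R j - Hsum R (j + m) + ln (j + m).+1%:R - (j + m)%:R^-1))%:E
    <= \int[P]_w f w.
Proof.
elim: m => [|m IH] d Omega P S f c p j p0 gS mf f0 fS jm; last first.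
  have [mS S0 _] := gS.
  have gS1 := gamma_variable_fst gS; have gS2 := gamma_variableD gS.
  pose S2 (z : Omega * T) := (S z.1 + `|z.2|)%R.
  pose D (z : Omega * T) := (ln (S2 z) - ln (S z.1))%:E.
  have SS2 z : (S z.1 <= S2 z)%R by rewrite lerDl.
  have D0 z : 0 <= D z.
    by rewrite lee_fin subr_ge0 ler_ln ?posrE// (lt_le_trans (S0 z.1)).
  have mD : measurable_fun setT D.
    apply/measurable_EFinP; apply: measurable_funB;
      apply: (measurableT_comp (@measurable_ln R)).
      by case: gS2.
    by case: gS1.
  have mfst : measurable_fun setT (fun z : Omega * T => f z.1).
    exact: measurableT_comp.
  (* Adding the non-negative increment, of expectation [p / (j+1)], restores the hypothesis of the
     lemma for the variable of the next shape. *)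
  pose f2 z := f z.1 + p%:E * D z.
  have mf2 : measurable_fun setT f2.
    by apply: emeasurable_funD => //; apply: emeasurable_funM.
  have f20 z : 0 <= f2 z by rewrite adde_ge0// mule_ge0.
  have fS2 z : (c + p * ln (S2 z))%:E <= f2 z.
    rewrite /f2 /D -EFinM.
    have -> : (c + p * ln (S2 z) = c + p * ln (S z.1) + p * (ln (S2 z) - ln (S z.1)))%R by ring.
    by rewrite EFinD leeD.
  have := IH _ _ _ _ _ _ _ j.+1 p0 gS2 mf2 f20 fS2; rewrite addSnnS => /(_ jm).
  have -> : \int[P \x exp1]_z f2 z = \int[P]_w f w + (p * j.+1%:R^-1)%:E.
    rewrite ge0_integralD//; last 2 first.
    - by move=> z _; rewrite mule_ge0.
    - by apply: emeasurable_funM.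
    rewrite integral_fst// ge0_integralZl//.
    by rewrite (gamma_ln_step gS1 gS2).
  rewrite -leeBlDr// -EFinB HsumS; apply: le_trans; rewrite lee_fin.
  by rewrite le_eqVlt; apply/orP; left; apply/eqP; ring.
case: j => // j in gS jm fS *; rewrite addn0 subrr add0r.
have [mS S0 _] := gS.
have mV : measurable_fun setT (fun w => ((S w)^-1)%:E).
  apply/measurable_EFinP; apply: (@eq_measurable_fun _ _ _ _ _ (fun w => expR (- ln (S w)))).
    by move=> w _; rewrite expRNln.
  apply: (measurableT_comp (f:=@expR R)) => //.
  apply: (measurableT_comp (f:=-%R : R -> R)) => //.
  exact: (measurableT_comp (@measurable_ln R)).
(* Here [j+2] is the shape of [S]. Adding this multiple of [1/S] gives a function bounded below by a
   constant, by [ln y <= y - 1] at [y = (j+2)/S]. *)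
pose g w := f w + (p * j.+2%:R)%:E * ((S w)^-1)%:E.
have V0 w : 0 <= ((S w)^-1)%:E by rewrite lee_fin invr_ge0 ltW.
have pj0 : 0 <= (p * j.+2%:R)%:E by rewrite lee_fin mulr_ge0.
have mg : measurable_fun setT g.
  by apply: emeasurable_funD => //; apply: emeasurable_funM.
have g0 w : 0 <= g w by rewrite adde_ge0// mule_ge0.
have gc w : (c + p * (ln j.+2%:R + 1))%:E <= g w.
  apply: (@le_trans _ _ ((c + p * ln (S w))%:E + (p * j.+2%:R)%:E * ((S w)^-1)%:E)); last first.
    by rewrite leeD2r.
  rewrite -EFinM -EFinD lee_fin -addrA lerD2l -mulrA -mulrDr ler_wpM2l//.
  have y0 : (0 < j.+2%:R / S w)%R by rewrite divr_gt0// ltr0n.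
  have := @le_ln1Dx R (j.+2%:R / S w - 1)%R.
  rewrite addrCA subrr addr0 ltrBrDr addNr => /(_ y0).
  rewrite ln_div ?posrE ?ltr0n//; lra.
have := probability_const_le P mg g0 gc.
rewrite ge0_integralD//; last 2 first.
- by move=> w _; rewrite mule_ge0.
- by apply: emeasurable_funM.
rewrite ge0_integralZl// (gamma_inv_expectation gS) -EFinM -leeBlDr// -EFinB.
apply: le_trans; rewrite lee_fin le_eqVlt; apply/orP; left; apply/eqP.
have j1 : (j.+1%:R != 0 :> R)%R by rewrite pnatr_eq0.
by rewrite -[j.+2%:R]natr1; field; rewrite -natr1 in j1.
Qed.

Lemma gamma_ln_bound d (Omega : measurableType d)
    (P : probability Omega R) (S : Omega -> R) (f : Omega -> \bar R) (c p : R) j :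
  (0 <= p)%R -> gamma_variable P S j.+1 -> measurable_fun setT f ->
  (forall w, 0 <= f w) -> (forall w, (c + p * ln (S w))%:E <= f w) ->
  (c + p * (Hsum R j - euler_gamma))%:E <= \int[P]_w f w.
Proof.
move=> p0 gS mf f0 fS; apply: (@euler_gamma_bound R _ c p _ j) => // N N0 jN.
have := @gamma_ln_bound_finite (N - j) _ _ P S f c p j p0 gS mf f0 fS.
by rewrite subnKC//; exact.
Qed.

(** This is the supporting line at [a] of the convex function [x |-> ln (1 + s exp x)], read at
    [x = ln y]; the slope is [q]. *)
Lemma ln1D_tangent (s a y : R) : (0 < s)%R -> (0 < y)%R ->
  (ln (1 + s * expR a) + s * expR a / (1 + s * expR a) * (ln y - a) <= ln (1 + s * y))%R.
Proof.
move=> s0 y0; set e := expR a; have e0 : (0 < e)%R by exact: expR_gt0.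
have se0 : (0 < 1 + s * e)%R by rewrite addr_gt0// mulr_gt0.
have sy0 : (0 < 1 + s * y)%R by rewrite addr_gt0// mulr_gt0.
set q := (_ / _)%R.
have q0 : (0 <= q)%R by rewrite divr_ge0 ?mulr_ge0 ?ltW.
have q1 : (0 <= 1 - q)%R.
  by rewrite subr_ge0 ler_pdivrMr// mul1r lerDr.
pose v := ((1 + s * y) / (1 + s * e))%R.
have v0 : (0 < v)%R by rewrite divr_gt0.
have lnv : ln v = (ln (1 + s * y) - ln (1 + s * e))%R by rewrite ln_div.
have lnu : ln (y / e) = (ln y - a)%R by rewrite ln_div// expRK.
have u0 : (0 < y / e)%R by rewrite divr_gt0.
have H (x : R) : (0 < x)%R -> (ln x <= x - 1)%R.
  move=> x0; have := @le_ln1Dx R (x - 1)%R.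
  by rewrite addrCA subrr addr0 ltrBrDr addNr; exact.
have H1 := H _ (divr_gt0 u0 v0); have H2 : (ln (v^-1) <= v^-1 - 1)%R by apply: H; rewrite invr_gt0.
rewrite ln_div ?posrE// lnu in H1; rewrite lnV ?posrE// in H2.
(* With [u = y / e], one has [v = q u + (1 - q)]; so the bounds [ln x <= x - 1] at [u / v] and
   [1 / v], weighted by [q] and [1 - q], add up to 0 on the right. *)
have E : (q * (y / e / v - 1) + (1 - q) * (v^-1 - 1) = 0)%R.
  rewrite /q /v; field.
  by rewrite !gt_eqF.
have := lerD (ler_wpM2l q0 H1) (ler_wpM2l q1 H2); rewrite E lnv.
move: (ln y - a)%R (ln (1 + s * y))%R (ln (1 + s * e))%R => A B C; nra.
Qed.

End gamma_log.

(** * The squared norm of a Gaussian vector *)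

Section gaussian_norm.
Context (R : realType) (I : finType).
Notation family := (g_sigma_algebraType (@cylinders R I)).
Notation mu := (@lebesgue_measure R).
Notation sigma := (Num.sqrt (2^-1) : R).
Notation nu := (normal_prob 0%R sigma).
Local Open Scope ereal_scope.

Lemma measurable_expR_sqr (t : R) :
  measurable_fun setT (fun x : R => (expR (- (t * x ^+ 2)))%:E).
Proof.
apply/measurable_EFinP; apply: (measurableT_comp (f:=@expR R)) => //.
apply: (measurableT_comp (f:=-%R : R -> R)) => //.
by apply: measurable_funM => //; exact: exprn_measurable.
Qed.

Lemma normal_laplace (t : R) : (0 <= t)%R ->
  \int[nu]_x (expR (- (t * x ^+ 2)))%:E = ((Num.sqrt (1 + t))^-1)%:E.
Proof.
move=> t0; have t1 : (0 < 1 + t)%R by rewrite ltr_pwDl.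
have st : (0 < Num.sqrt (1 + t))%R by rewrite sqrtr_gt0.
rewrite ge0_integral_normal; last 2 first.
- exact: measurable_expR_sqr.
- by move=> x; rewrite lee_fin expR_ge0.
(* The standard deviation whose normal density is proportional to [exp (- (1 + t) x^2)]. *)
pose s := Num.sqrt ((2 * (1 + t))^-1)%R.
have s2 : (s ^+ 2 *+ 2 = (1 + t)^-1)%R.
  rewrite sqr_sqrtr ?invr_ge0 ?mulr_ge0 ?ltW//.
  by rewrite -mulr_natr invfM mulrAC mulVf ?mul1r// pnatr_eq0.
have s0 : s != 0%R by rewrite gt_eqF// sqrtr_gt0 invr_gt0 mulr_gt0.
transitivity (((Num.sqrt (1 + t))^-1)%:E * \int[mu]_x (normal_pdf 0 s x)%:E); last first.
  by rewrite integral_normal_pdf mule1.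
rewrite -ge0_integralZl; last 4 first.
- exact: measurableT.
- by apply/measurable_EFinP; exact: measurable_normal_pdf.
- by move=> x _; rewrite lee_fin normal_pdf_ge0.
- by rewrite lee_fin invr_ge0 ltW.
apply: eq_integral => x _; rewrite -!EFinM; congr (_%:E).
rewrite normal_pdf_half normal_pdfE// /normal_peak /normal_fun subr0 -mulrnAl s2.
rewrite sqrtrM ?invr_ge0 ?(ltW t1)// sqrtrV ?(ltW t1)// invfM !invrK.
rewrite mulrCA -expRD !mulrA mulVf ?gt_eqF// mul1r; congr (_ * expR _)%R.
ring.
Qed.

Lemma integral_normal_law d (Omega : measurableType d) (P : probability Omega R)
    (X : Omega -> R) (f : R -> \bar R) :
  has_normal_law P X 0 sigma -> measurable_fun setT f -> (forall x, 0 <= f x) ->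
  \int[P]_w f (X w) = \int[nu]_x f x.
Proof.
move=> [mX lX] mf f0.
pose T := measurableTypeR R.
have mX' : @measurable_fun _ _ Omega T setT X by exact: mX.
have mf' : @measurable_fun _ _ T (\bar R) setT f by exact: mf.
have := @ge0_integral_pushforward _ _ Omega T R X mX' P setT f measurableT mf'.
rewrite preimage_setT => <-; last by move=> x _; exact: f0.
apply: (@eq_measure_integral _ T R _ nu
  (measure_function_pushforward__canonical__measure_function_Measure P mX')).
by move=> A mA _; exact: lX.
Qed.

(** Induction on the list of coordinates: its head is moved to a separate factor by
    [gaussian_family_split], so the integral becomes a product. *)
Lemma gaussian_laplace d (Omega : measurableType d) (P : probability Omega R)
    (X : I -> Omega -> R) (t : R) (l : seq I) :
  (0 <= t)%R -> gaussian_family P X -> uniq l ->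
  \int[P]_w (expR (- (t * \sum_(i <- l) X i w ^+ 2)))%:E =
  ((Num.sqrt (1 + t))^-1 ^+ size l)%:E.
Proof.
move=> t0 gX; have [_ nX] := gX; have mX i := (nX i).1.
elim: l => [_|c l IH /= /andP[cl ul]].
  under eq_integral do rewrite big_nil mulr0 oppr0 expR0.
  by rewrite integral_cst// [X in _ * X](probability_setT P) mule1 expr0.
have mS d' (T' : measurableType d') (Y : I -> T' -> R) r :
    (forall i, measurable_fun setT (Y i)) ->
    measurable_fun setT (fun w => (expR (- (t * \sum_(i <- r) Y i w ^+ 2)))%:E).
  move=> mY; apply/measurable_EFinP; apply: (measurableT_comp (f:=@expR R)) => //.
  apply: (measurableT_comp (f:=-%R : R -> R)) => //.
  apply: measurable_funM => //; apply: measurable_sum => i.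
  by apply: (measurableT_comp (f:=fun x : R => x ^+ 2)%R) => //; exact: exprn_measurable.
have gX2 := gaussian_family_split (pred1 c) gX gX.
pose F (x : family) := (expR (- (t * \sum_(i <- c :: l) x i ^+ 2)))%:E.
have mF : measurable_fun setT F.
  by apply: (mS _ family (fun i x => x i)) => i; exact: measurable_coord.
have F0 x : 0 <= F x by rewrite lee_fin expR_ge0.
rewrite [LHS](gaussian_family_law gX gX2 mF F0).
pose G (z : Omega * Omega) :=
  (expR (- (t * X c z.1 ^+ 2)))%:E * (expR (- (t * \sum_(i <- l) X i z.2 ^+ 2)))%:E.
have m1 : measurable_fun setT (fun w => (expR (- (t * X c w ^+ 2)))%:E).
  exact: (measurableT_comp (measurable_expR_sqr t) (mX c)).
transitivity (\int[P \x P]_z G z).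
  apply: eq_integral => z _; rewrite /F /G big_cons /= eqxx -EFinM -expRD.
  congr ((expR _)%:E); rewrite mulrDr opprD; congr (_ - t * _)%R.
  apply: eq_big_seq => i il; rewrite ifF//.
  by apply: contraNF cl => /eqP <-.
rewrite (@fubini_tonelli1 _ _ _ _ _ P P G); last 2 first.
- apply: emeasurable_funM.
    exact: (measurableT_comp m1 measurable_fst).
  exact: (measurableT_comp (mS _ _ X l mX) measurable_snd).
- by move=> z; rewrite mule_ge0// lee_fin expR_ge0.
transitivity (\int[P]_w ((expR (- (t * X c w ^+ 2)))%:E *
    ((Num.sqrt (1 + t))^-1 ^+ size l)%:E)).
  apply: eq_integral => w _; rewrite /fubini_F /G/= -IH// ge0_integralZl//.
  exact: mS.
rewrite ge0_integralZr//.
rewrite (integral_normal_law (nX c) (measurable_expR_sqr t)); last first.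
  by move=> x; rewrite lee_fin expR_ge0.
by rewrite normal_laplace// -EFinM exprS.
Qed.

(** Each square of a normal variable of variance 1/2 contributes [(1 + t)^(-1/2)] to the Laplace
    transform, so [2 (j+1)] of them form a Gamma variable of shape [j+1]. *)
Lemma gaussian_ln_bound d (Omega : measurableType d) (P : probability Omega R)
    (X : I -> Omega -> R) (j : nat) (s : R) :
  (0 < s)%R -> gaussian_family P X -> #|I| = (2 * j.+1)%N ->
  (ln (1 + s * expR (Hsum R j - euler_gamma)))%:E <=
  \int[P]_w (ln (1 + s * \sum_i X i w ^+ 2))%:E.
Proof.
move=> s0 gX cI; have [_ nX] := gX; have mX i := (nX i).1.
pose N w := (\sum_i X i w ^+ 2)%R.
have N0 w : (0 <= N w)%R by apply: sumr_ge0 => i _; exact: sqr_ge0.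
have mN : measurable_fun setT N.
  apply: measurable_sum => i.
  by apply: (measurableT_comp (f:=fun x : R => x ^+ 2)%R) => //; exact: exprn_measurable.
(* A Gamma variable is required to be positive everywhere. The norm vanishes only on the null set
   [Z], where [S] is raised to 1 without affecting any integral. *)
pose Z := N @^-1` [set 0%R].
have mZ : measurable Z by exact: measurable_preimT.
have PZ : P Z = 0.
  have /card_gt0P[i0 _] : (0 < #|I|)%N by rewrite cI.
  apply/eqP; rewrite -measure_le0.
  have <- : P (X i0 @^-1` [set 0%R]) = 0.
    by rewrite (nX i0).2// /normal_prob integral_set1.
  apply: le_measure; rewrite ?inE//; first exact: measurable_preimT.
  move=> w /= /eqP; rewrite psumr_eq0; last by move=> i _; exact: sqr_ge0.
  by move=> /allP/(_ i0); rewrite mem_index_enum sqrf_eq0 => /(_ isT)/eqP.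
pose S w := (N w + \1_Z w)%R.
have mS : measurable_fun setT S.
  by apply: measurable_funD => //; exact: measurable_indic.
have S0 w : (0 < S w)%R.
  rewrite /S indicE; have [wZ|wZ] := boolP (w \in Z); first by rewrite ltr_wpDl.
  rewrite addr0 lt_neqAle N0 andbT eq_sym; apply: contra wZ => /eqP Nw.
  by rewrite inE.
have SN (h : R -> R) : measurable_fun setT h ->
    \int[P]_w (h (S w))%:E = \int[P]_w (h (N w))%:E.
  move=> mh; apply: ae_eq_integral => //.
  - by apply/measurable_EFinP; exact: measurableT_comp.
  - by apply/measurable_EFinP; exact: measurableT_comp.
  - exists Z; split=> // w /= wN; apply: contrapT => wZ; apply: wN => _.
    by rewrite /S indicE memNset// addr0.
have gS : gamma_variable P S j.+1.
  split=> // t t0.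
  rewrite (SN (fun x => expR (- (t * x)))); last first.
    by apply: (measurableT_comp (f:=@expR R)) => //; apply: (measurableT_comp (f:=-%R : R -> R)) => //; exact: measurable_funM.
  have := gaussian_laplace t0 gX (enum_uniq I).
  rewrite -cardE cI exprM exprVn sqr_sqrtr; last by rewrite addr_ge0.
  rewrite exprVn => <-; apply: eq_integral => w _.
  by rewrite /N big_enum.
have mL : measurable_fun setT (fun x : R => ln (1 + s * x)).
  apply: (measurableT_comp (@measurable_ln R)).
  by apply: measurable_funD => //; exact: measurable_funM.
rewrite -[leRHS](SN (fun x => ln (1 + s * x)))//.
set a := (Hsum R j - euler_gamma)%R.
pose q := (s * expR a / (1 + s * expR a))%R.
have q0 : (0 <= q)%R by rewrite divr_ge0 ?mulr_ge0 ?addr_ge0 ?mulr_ge0 ?expR_ge0 ?ltW.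
(* The constants are the intercept and the slope of the supporting line at [a = H_j - gamma]; with
   this [a] the bound evaluates to the height of the curve at the point of contact. *)
have := @gamma_ln_bound R _ _ P S (fun w => (ln (1 + s * S w))%:E)
   (ln (1 + s * expR a) - q * a)%R q j q0 gS.
rewrite -/a subrK; apply.
- by apply/measurable_EFinP; exact: (measurableT_comp mL).
- by move=> w; rewrite lee_fin ln_ge0// lerDl mulr_ge0 ?ltW.
- move=> w; rewrite lee_fin; have := @ln1D_tangent R s a (S w) s0 (S0 w).
  by rewrite -/q mulrBr; lra.
Qed.

End gaussian_norm.

Local Open Scope complex_scope.

(** * Unitary matrices acting on Gaussian rows *)

Section adjoint.
Context (R : rcfType).
Implicit Types m n p : nat.

Lemma adjmxE m n (A : 'M[R[i]]_(m, n)) i j : adjmx A i j = (A j i)^*.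
Proof. by rewrite !mxE. Qed.

Lemma adjmxM m n p (A : 'M[R[i]]_(m, n)) (B : 'M[R[i]]_(n, p)) :
  adjmx (A *m B) = adjmx B *m adjmx A.
Proof. by rewrite /adjmx trmx_mul map_mxM. Qed.

Lemma adjmxK m n (A : 'M[R[i]]_(m, n)) : adjmx (adjmx A) = A.
Proof. by apply/matrixP => i j; rewrite !adjmxE conjcK. Qed.

Lemma adjmx1 n : adjmx (1%:M : 'M[R[i]]_n) = 1%:M.
Proof. by rewrite /adjmx trmx1 map_mx1. Qed.

End adjoint.

Section gaussian_rows.
Context (R : realType).

Definition part (b : bool) (z : R[i]) : R :=
  if b then complex.Im z else complex.Re z.

Definition gaussian_rows d (Omega : measurableType d) (P : probability Omega R)
    (J : finType) n (Z : J -> Omega -> 'rV[R[i]]_n) : Prop :=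
  gaussian_family P
    (fun (c : J * 'I_n * bool) w => part c.2 (Z c.1.1 w ord0 c.1.2)).

(** Preservation of the Gaussian law is bundled with unitarity. It is checked on phases and plane
    rotations and passes to products. *)
Definition gaussian_unitary n (U : 'M[R[i]]_n) : Prop :=
  U *m adjmx U = 1%:M /\
  forall d (Omega : measurableType d) (P : probability Omega R) (J : finType)
    (Z : J -> Omega -> 'rV[R[i]]_n),
  gaussian_rows P Z -> gaussian_rows P (fun j w => Z j w *m U).

Lemma gaussian_unitary1 n : gaussian_unitary (1%:M : 'M[R[i]]_n).
Proof.
split=> [|d Omega P J Z gZ]; first by rewrite adjmx1 mulmx1.
by under eq_fun do under eq_fun do rewrite mulmx1.
Qed.

Lemma gaussian_unitaryM n (U V : 'M[R[i]]_n) :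
  gaussian_unitary U -> gaussian_unitary V -> gaussian_unitary (U *m V).
Proof.
move=> [U1 gU] [V1 gV]; split=> [|d Omega P J Z gZ].
  by rewrite adjmxM mulmxA -(mulmxA U) V1 mulmx1.
have := gV _ _ _ _ _ (gU _ _ _ _ _ gZ).
by under eq_fun do under eq_fun do rewrite -mulmxA.
Qed.

(** A matrix acts on all rows at once, which rotates many disjoint pairs of real coordinates by one
    angle. The induction on the list of pairs peels off one rotation at a time. *)
Lemma gaussian_family_rotations d (Omega : measurableType d)
    (P : probability Omega R) (I T : finType) (a b : T -> I) (c s : R)
    (X Y : I -> Omega -> R) :
  injective a -> injective b -> (forall t t', a t != b t') ->
  c ^+ 2 + s ^+ 2 = 1 ->
  (forall t w, Y (a t) w = c * X (a t) w - s * X (b t) w) ->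
  (forall t w, Y (b t) w = s * X (a t) w + c * X (b t) w) ->
  (forall i, (forall t, i != a t) -> (forall t, i != b t) -> Y i = X i) ->
  gaussian_family P X -> gaussian_family P Y.
Proof.
move=> ai bi ab cs1 Ya Yb Yn gX.
suff H (l : seq T) : uniq l -> forall Z : I -> Omega -> R,
    (forall t w, t \in l -> Z (a t) w = c * X (a t) w - s * X (b t) w) ->
    (forall t w, t \in l -> Z (b t) w = s * X (a t) w + c * X (b t) w) ->
    (forall i, (forall t, t \in l -> i != a t) -> (forall t, t \in l -> i != b t) ->
       Z i = X i) -> gaussian_family P Z.
  apply: (H (enum T) (enum_uniq T) Y) => [t w _|t w _|i ia ib].
  - exact: Ya.
  - exact: Yb.
  - by apply: Yn => t; [apply: ia|apply: ib]; rewrite mem_enum.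
elim: l => [_ Z _ _ ZX|t0 l IH /andP[t0l ul] Z Za Zb ZX].
  by have -> : Z = X by apply/funext => i; exact: ZX.
(* [Z0] is [Z] before the pair [t0] has been rotated. *)
pose Z0 i := if i == a t0 then X (a t0) else if i == b t0 then X (b t0) else Z i.
have gZ0 : gaussian_family P Z0.
  apply: IH => // [t w tl|t w tl|i ia ib].
  - have tt0 : t != t0 by apply: contraNneq t0l => <-.
    rewrite /Z0 (inj_eq ai) (negPf tt0) (negPf (ab _ _)) Za// inE tl orbT//.
  - have tt0 : t != t0 by apply: contraNneq t0l => <-.
    by rewrite /Z0 (inj_eq bi) (negPf tt0) eq_sym (negPf (ab _ _)) Zb// inE tl orbT.
  - rewrite /Z0; case: eqP => [->//|/eqP ia0]; case: eqP => [->//|/eqP ib0].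
    by apply: ZX => t; rewrite inE => /predU1P[->//|]; [exact: ia|exact: ib].
have := gaussian_family_rotation (ab t0 t0) cs1 gZ0.
congr (gaussian_family P _); apply/funext => i; apply/funext => w.
rewrite /rotate_family /Z0 !eqxx (eq_sym (b t0)) (negPf (ab _ _)).
case: eqP => [->|_]; first by rewrite Za// mem_head.
by case: eqP => [->|_//]; rewrite Zb// mem_head.
Qed.

Definition phase_mx n (k : 'I_n) (u : R[i]) : 'M[R[i]]_n :=
  diag_mx (\row_i (if i == k then u else 1)).

Lemma mulmx_phase n (k : 'I_n) (u : R[i]) (v : 'rV[R[i]]_n) j :
  (v *m phase_mx k u) ord0 j = if j == k then v ord0 j * u else v ord0 j.
Proof. by rewrite mul_mx_diag !mxE; case: eqP => _ //; rewrite mulr1. Qed.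

Lemma row_actP n (U V : 'M[R[i]]_n) :
  (forall (v : 'rV[R[i]]_n), v *m U = v *m V) -> U = V.
Proof.
by move=> UV; apply/row_matrixP => i; rewrite !rowE UV.
Qed.

Lemma gaussian_unitary_phase n (k : 'I_n) (u : R[i]) : `|u| = 1 ->
  gaussian_unitary (phase_mx k u).
Proof.
move=> u1; split.
  have -> : adjmx (phase_mx k u) = phase_mx k u^*.
    apply/matrixP => i j; rewrite adjmxE !mxE [j == i]eq_sym.
    have [->|_] := eqVneq i j; last by rewrite !mulr0n conjc0.
    by rewrite !mulr1n; case: eqP => _; rewrite ?conjc1.
  apply: row_actP => v; apply/rowP => j.
  rewrite mulmx1 mulmxA !mulmx_phase; case: eqP => // _.
  by rewrite -mulrA -sqr_normc u1 expr1n mulr1.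
move=> d Omega P J Z gZ.
(* Multiplication by a unit [u] rotates the pair of real and imaginary parts, with cosine [Re u] and
   sine [Im u]. *)
have cs1 : complex.Re u ^+ 2 + complex.Im u ^+ 2 = 1.
  by apply: complexI; rewrite add_Re2_Im2 u1 expr1n.
apply: (@gaussian_family_rotations _ _ _ _ J (fun j => (j, k, false))
  (fun j => (j, k, true)) _ _ _ _ _ _ _ cs1 _ _ _ gZ).
- by move=> j j' [].
- by move=> j j' [].
- by move=> j j'; apply/eqP => -[].
- move=> j w /=; rewrite mulmx_phase eqxx /part.
  by case: (Z j w ord0 k) u {u1 cs1} => [x y] [x' y'] /=; ring.
- move=> j w /=; rewrite mulmx_phase eqxx /part.
  by case: (Z j w ord0 k) u {u1 cs1} => [x y] [x' y'] /=; ring.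
- move=> [[j l] b] /= na nb; apply/funext => w; rewrite mulmx_phase.
  case: eqP => [lk|//]; case: b na nb => na nb.
    by have := nb j; rewrite lk eqxx.
  by have := na j; rewrite lk eqxx.
Qed.

Definition givens_mx n (k l : 'I_n) (c s : R) : 'M[R[i]]_n :=
  \matrix_(i, j) if j == k then c%:C *+ (i == k) - s%:C *+ (i == l) else
                 if j == l then s%:C *+ (i == k) + c%:C *+ (i == l) else
                 (i == j)%:R.

Lemma mulmx_givens n (k l : 'I_n) (c s : R) (v : 'rV[R[i]]_n) j :
  (v *m givens_mx k l c s) ord0 j =
  if j == k then c%:C * v ord0 k - s%:C * v ord0 l else
  if j == l then s%:C * v ord0 k + c%:C * v ord0 l else v ord0 j.
Proof.
have sum1 (x : R[i]) m : \sum_i v ord0 i * (x *+ (i == m)) = x * v ord0 m.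
  rewrite (bigD1 m)//= eqxx mulr1n big1 ?addr0 1?mulrC// => i im.
  by rewrite (negPf im) mulr0.
rewrite mxE; under eq_bigr do rewrite mxE.
case: eqP => _; [|case: eqP => _].
- by under eq_bigr do rewrite mulrBr; rewrite sumrB !sum1.
- by under eq_bigr do rewrite mulrDr; rewrite big_split/= !sum1.
- by rewrite sum1 mul1r.
Qed.

Lemma gaussian_unitary_givens n (k l : 'I_n) (c s : R) : k != l ->
  c ^+ 2 + s ^+ 2 = 1 -> gaussian_unitary (givens_mx k l c s).
Proof.
move=> kl cs1; have lk : (l == k) = false by rewrite eq_sym (negPf kl).
split.
  have -> : adjmx (givens_mx k l c s) = givens_mx k l c (- s).
    apply/matrixP => i j; rewrite adjmxE !mxE.
    have [->|ik] := eqVneq i k; have [->|jk] := eqVneq j k.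
    - by rewrite ?eqxx ?(negPf kl) ?mulr0n ?mulr1n ?subr0 ?oppr0 ?subr0 conjc_real.
    - rewrite ?eqxx ?(negPf kl) ?mulr0n ?mulr1n ?sub0r ?addr0.
      have [_|_] := eqVneq j l; first by rewrite mulr1n; apply/eqP; rewrite eq_complex/= ?opprK ?oppr0 ?eqxx.
      by apply/eqP; rewrite ?mulr0n ?oppr0 ?conjc0 eq_complex/= ?opprK ?oppr0 ?addr0 ?eqxx.
    - rewrite ?eqxx ?(negPf kl) ?mulr0n ?mulr1n ?sub0r ?addr0.
      have [_|_] := eqVneq i l; first by rewrite mulr1n; apply/eqP; rewrite eq_complex/= ?opprK ?oppr0 ?eqxx.
      by rewrite eq_sym (negPf ik) mulr0n oppr0 conjc0.
    - rewrite ?mulr0n ?oppr0 ?add0r.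
      have [il|il] := eqVneq i l; have [jl|jl] := eqVneq j l.
      + by rewrite mulr1n conjc_real.
      + by rewrite il eq_sym (negPf jl) conjc0.
      + by rewrite jl eq_sym (negPf il) conjc0.
      + by rewrite conjc_nat eq_sym.
  apply: row_actP => v; apply/rowP => j.
  rewrite mulmx1 mulmxA !mulmx_givens !eqxx lk.
  have cs1' : c%:C ^+ 2 + s%:C ^+ 2 = 1 by rewrite -!rmorphXn -rmorphD cs1.
  rewrite rmorphN; case: eqP => [->|_]; [|case: eqP => [->|//]].
  - by rewrite -[RHS]mul1r -cs1'; ring.
  - by rewrite -[RHS]mul1r -cs1'; ring.
move=> d Omega P J Z gZ.
(* As [c] and [s] are real, real and imaginary parts rotate separately: there is one pair for each
   row and each [bool]. *)
apply: (@gaussian_family_rotations _ _ _ _ (J * bool)%type (fun j => (j.1, k, j.2))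
  (fun j => (j.1, l, j.2)) _ _ _ _ _ _ _ cs1 _ _ _ gZ).
- by move=> [j b] [j' b'] /= [-> ->].
- by move=> [j b] [j' b'] /= [-> ->].
- by move=> j j'; apply: contraNneq kl => -[_ ->].
- move=> [j b] w /=; rewrite mulmx_givens eqxx /part.
  case: (Z j w ord0 k) (Z j w ord0 l) => [x y] [x' y'].
  by case: b => /=; ring.
- move=> [j b] w /=; rewrite mulmx_givens eqxx lk /part.
  case: (Z j w ord0 k) (Z j w ord0 l) => [x y] [x' y'].
  by case: b => /=; ring.
- move=> [[j m] b] /= na nb; apply/funext => w; rewrite mulmx_givens.
  case: eqP => [mk|_]; first by have := na (j, b); rewrite /= mk eqxx.
  by case: eqP => [ml|//]; have := nb (j, b); rewrite /= ml eqxx.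
Qed.

(* A phase makes the two entries real multiples of each other, then a real
   rotation kills the second one. *)
Lemma gaussian_unitary_kill n (v : 'rV[R[i]]_n) (k l : 'I_n) : k != l ->
  exists U : 'M[R[i]]_n, [/\ gaussian_unitary U, (v *m U) ord0 l = 0 &
    forall j, j != k -> j != l -> (v *m U) ord0 j = v ord0 j].
Proof.
move=> kl; pose z := v ord0 k; pose y := v ord0 l.
have [y0|y0] := eqVneq y 0.
  exists 1%:M; split; first exact: gaussian_unitary1.
    by rewrite mulmx1.
  by move=> j _ _; rewrite mulmx1.
have [z0|z0] := eqVneq z 0.
  exists (givens_mx k l 0 1); split.
  - by apply: gaussian_unitary_givens => //; rewrite expr0n add0r expr1n.
  - by rewrite mulmx_givens eqxx [l == k]eq_sym (negPf kl) -/z z0 mulr0 mul0r addr0.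
  - by move=> j jk jl; rewrite mulmx_givens (negPf jk) (negPf jl).
have [t tE] : exists t : R, `|y| / `|z| = t%:C.
  by apply/complex_realP; rewrite realM ?realV ?normr_real.
pose u := `|y| / y * (z / `|z|).
have u1 : `|u| = 1.
  by rewrite !normrM !normfV !normr_id divff ?normr_eq0// divff ?normr_eq0// mulr1.
pose q := Num.sqrt (1 + t ^+ 2).
have q2 : q ^+ 2 = 1 + t ^+ 2 by rewrite sqr_sqrtr// addr_ge0 ?sqr_ge0.
have q0 : q != 0 by rewrite -sqrf_eq0 q2 gt_eqF// ltr_pwDl ?sqr_ge0.
exists (phase_mx l u *m givens_mx k l q^-1 (- t / q)); split.
- apply: gaussian_unitaryM; first exact: gaussian_unitary_phase.
  apply: gaussian_unitary_givens => //.
  rewrite !exprMn !exprVn sqrrN q2; field.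
  by rewrite -q2 sqrf_eq0.
- rewrite mulmxA mulmx_givens !mulmx_phase eqxx [l == k]eq_sym (negPf kl) -/z -/y.
  have nz : `|z| != 0 by rewrite normr_eq0.
  have -> : y * u = t%:C * z by rewrite -tE /u; field; rewrite nz y0.
  rewrite !rmorphM rmorphN; ring.
- move=> j jk jl; rewrite mulmxA mulmx_givens !mulmx_phase.
  by rewrite (negPf jk) (negPf jl).
Qed.

(** Entries are cleared one by one against entry 0. Each step leaves the other entries alone, so
    those already cleared stay zero. *)
Lemma gaussian_unitary_exists n (v : 'rV[R[i]]_n.+1) :
  exists U : 'M[R[i]]_n.+1, gaussian_unitary U /\
    forall j, j != ord0 -> (v *m U) ord0 j = 0.
Proof.
suff H m : exists U : 'M[R[i]]_n.+1, gaussian_unitary U /\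
    forall j, j != ord0 -> (j <= m)%N -> (v *m U) ord0 j = 0.
  have [U [gU U0]] := H n; exists U; split=> // j j0; apply: U0 => //.
  by rewrite -ltnS.
elim: m => [|m [U [gU U0]]].
  exists 1%:M; split=> [|j j0 jm]; first exact: gaussian_unitary1.
  by case/negP: j0; rewrite -val_eqE/= -leqn0.
have [mn|nm] := ltnP m n; last first.
  exists U; split=> // j j0 _; apply: U0 => //.
  by rewrite (leq_trans _ nm)// -ltnS.
have k0 : ord0 != Ordinal (mn : (m.+1 < n.+1)%N) by [].
have [V [gV V0 VE]] := gaussian_unitary_kill (v *m U) k0.
exists (U *m V); split=> [|j j0]; first exact: gaussian_unitaryM.
rewrite leq_eqVlt ltnS mulmxA => /orP[jm|jm].
  by rewrite (_ : j = Ordinal (mn : (m.+1 < n.+1)%N))//; exact/val_inj/eqP.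
rewrite VE//; first exact: U0.
by rewrite -val_eqE/= neq_ltn ltnS jm.
Qed.

End gaussian_rows.

(** * Gram determinants *)

(** Both sides are the determinant of one block matrix, factored in two ways. *)
Lemma det_sylvester (F : comNzRingType) m n (A : 'M[F]_(m, n)) (B : 'M[F]_(n, m)) :
  \det (1%:M + A *m B) = \det (1%:M + B *m A).
Proof.
pose M := block_mx (1%:M : 'M[F]_m) (- A) B (1%:M : 'M[F]_n).
transitivity (\det M).
  have -> : M = block_mx 1%:M (- A) 0 1%:M *m block_mx (1%:M + A *m B) 0 B 1%:M.
    rewrite mulmx_block ?(mul1mx, mulmx1, mul0mx, mulmx0, add0r, addr0).
    by rewrite mulNmx addrK.
  by rewrite det_mulmx det_ublock det_lblock !det1 !mulr1 mul1r.
have -> : M = block_mx 1%:M 0 B 1%:M *m block_mx 1%:M (- A) 0 (1%:M + B *m A).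
  rewrite mulmx_block ?(mul1mx, mulmx1, mul0mx, mulmx0, add0r, addr0).
  by rewrite mulmxN addrC addrK.
by rewrite det_mulmx det_lblock det_ublock !det1 !mul1r.
Qed.

Section gram.
Context (R : rcfType).
Implicit Types (m n : nat) (s : R).
Notation C := R[i].

Lemma adjmxD m n (A B : 'M[C]_(m, n)) : adjmx (A + B) = adjmx A + adjmx B.
Proof. by rewrite /adjmx linearD map_mxD. Qed.

Lemma adjmxZ m n (u : C) (A : 'M[C]_(m, n)) : adjmx (u *: A) = conjc u *: adjmx A.
Proof. by apply/matrixP => i j; rewrite !mxE rmorphM. Qed.

Lemma adjmx0 m n : adjmx (0 : 'M[C]_(m, n)) = 0.
Proof. by rewrite /adjmx trmx0 map_mx0. Qed.

Lemma adjmx_block m1 m2 n1 n2 (A : 'M[C]_(m1, n1)) (B : 'M[C]_(m1, n2))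
    (D : 'M[C]_(m2, n1)) (E : 'M[C]_(m2, n2)) :
  adjmx (block_mx A B D E) = block_mx (adjmx A) (adjmx D) (adjmx B) (adjmx E).
Proof. by rewrite /adjmx tr_block_mx map_block_mx. Qed.

Definition gram_det s m n (G : 'M[C]_(m, n)) : C :=
  \det (1%:M + s%:C *: (G *m adjmx G)).

Lemma gram_det_tr s m n (G : 'M[C]_(m, n)) : gram_det s G^T = gram_det s G.
Proof.
rewrite /gram_det -det_tr linearD/= trmx1 linearZ/= trmx_mul trmxK.
have -> : (adjmx G^T)^T = adjmx G by apply/matrixP => i j; rewrite !mxE.
by rewrite scalemxAl det_sylvester -scalemxAr.
Qed.

Lemma gram_det_unitary s m n (G : 'M[C]_(m, n)) (U : 'M[C]_n) :
  U *m adjmx U = 1%:M -> gram_det s (G *m U) = gram_det s G.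
Proof.
by move=> U1; rewrite /gram_det adjmxM mulmxA -(mulmxA G) U1 mulmx1.
Qed.

Lemma gram_det_scale s m n (G : 'M[C]_(m, n)) (u : C) :
  `|u| = 1 -> gram_det s (u *: G) = gram_det s G.
Proof.
move=> u1; rewrite /gram_det; congr (\det (_ + _ *: _)).
by rewrite adjmxZ -scalemxAl -scalemxAr scalerA -sqr_normc u1 expr1n scale1r.
Qed.

Lemma adjmx_sqr_ge0 n (y : 'cV[C]_n) : 0 <= (adjmx y *m y) ord0 ord0.
Proof.
rewrite mxE sumr_ge0// => i _; rewrite adjmxE mulrC; exact: mulcJ_ge0.
Qed.

Lemma adjmx_sqr_eq0 n (y : 'cV[C]_n) : (adjmx y *m y) ord0 ord0 = 0 -> y = 0.
Proof.
rewrite mxE => /eqP; rewrite psumr_eq0 => [/allP y0|i _]; last first.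
  by rewrite adjmxE mulrC; exact: mulcJ_ge0.
apply/colP => i; have := y0 i; rewrite mem_index_enum adjmxE => /(_ isT).
by rewrite mulrC -sqr_normc sqrf_eq0 normr_eq0 mxE => /eqP.
Qed.

Section rank_one_update.
Variables (s : R) (m n : nat) (G : 'M[C]_(m, n)).
Hypothesis s0 : 0 <= s.
Let A := 1%:M + s%:C *: (G *m adjmx G).

Lemma gram_form_ge (y : 'cV[C]_m) :
  (adjmx y *m y) ord0 ord0 <= (adjmx y *m A *m y) ord0 ord0.
Proof.
rewrite /A mulmxDr mulmx1 mulmxDl [leRHS]mxE lerDl.
rewrite -scalemxAr -scalemxAl mxE mulr_ge0 ?ler0c//.
have -> : adjmx y *m (G *m adjmx G) *m y = adjmx (adjmx G *m y) *m (adjmx G *m y).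
  by rewrite adjmxM adjmxK !mulmxA.
exact: adjmx_sqr_ge0.
Qed.

(** By [gram_form_ge], a vector [y] with [A y = 0] satisfies [y^H y <= 0]. *)
Lemma gram_unit : A \in unitmx.
Proof.
rewrite -unitmx_tr -row_free_unit -kermx_eq0; apply/eqP/row_matrixP => i.
set x := row i _; rewrite row0.
have xA : x *m A^T = 0.
  by apply/sub_kermxP; rewrite /x row_sub.
have Ay : A *m x^T = 0 by rewrite -[A]trmxK -trmx_mul xA trmx0.
have := gram_form_ge x^T; rewrite -mulmxA Ay mulmx0 [leRHS]mxE => le0.
suff : x^T = 0 by move=> /(congr1 trmx); rewrite trmxK trmx0.
by apply: adjmx_sqr_eq0; apply/eqP; rewrite eq_le le0 adjmx_sqr_ge0.
Qed.

(** The witness is [q = b^H A^-1 b]. With [b = A y] and [A] Hermitian it equals [y^H A y], which is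
    at least [y^H y]. *)
Lemma det_rank_one (c : R) (b : 'cV[C]_m) : 0 <= c ->
  exists2 q : C, 0 <= q & \det (A + c%:C *: (b *m adjmx b)) = \det A * (1 + c%:C * q).
Proof.
move=> c0; pose y := invmx A *m b.
have bE : b = A *m y by rewrite /y mulKVmx ?gram_unit.
have AH : adjmx A = A.
  by rewrite /A adjmxD adjmx1 adjmxZ adjmxM adjmxK conjc_real.
exists ((adjmx b *m y) ord0 ord0).
  rewrite bE adjmxM AH -mulmxA; apply: le_trans (adjmx_sqr_ge0 y) _.
  by rewrite mulmxA; exact: gram_form_ge.
have -> : A + c%:C *: (b *m adjmx b) = A *m (1%:M + y *m (c%:C *: adjmx b)).
  by rewrite mulmxDr mulmx1 mulmxA -bE scalemxAr.
rewrite det_mulmx det_sylvester det_mx11 -scalemxAl; congr (_ * _).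
by rewrite !mxE.
Qed.

End rank_one_update.

(** [G G^H] is a sum of rank one terms, one for each column, and every one of them multiplies the
    determinant by a factor at least 1. *)
Lemma gram_det_ge1 s m n (G : 'M[C]_(m, n)) : 0 <= s -> 1 <= gram_det s G.
Proof.
move=> s0; rewrite /gram_det; elim: n => [|n IH] in G *.
  by rewrite [G]thinmx0 mul0mx scaler0 addr0 det1.
pose b : 'M[C]_(m, 1) := lsubmx (G : 'M[C]_(m, 1 + n)).
pose G' : 'M[C]_(m, n) := rsubmx (G : 'M[C]_(m, 1 + n)).
have -> : G *m adjmx G = G' *m adjmx G' + b *m adjmx b.
  transitivity (row_mx b G' *m adjmx (row_mx b G')); first by rewrite hsubmxK.
  by rewrite /adjmx tr_row_mx map_col_mx mul_row_col addrC.
rewrite scalerDr addrA.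
have [q q0 ->] := det_rank_one G' s0 b s0.
by rewrite (le_trans (IH G'))// ler_peMr ?(le_trans ler01 (IH G'))// lerDl mulr_ge0 ?ler0c.
Qed.

(* Schur complement with respect to the first row [r 0 ... 0]: what remains is
   the Gram matrix of the lower right block plus a nonnegative rank one term. *)
Lemma gram_det_schur s m n (G : 'M[C]_(1 + m, 1 + n)) : 0 <= s ->
  ursubmx G = 0 ->
  (1 + s%:C * `|G ord0 ord0| ^+ 2) * gram_det s (drsubmx G) <= gram_det s G.
Proof.
move=> s0 G0.
pose r := ulsubmx G; pose b := dlsubmx G; pose G' := drsubmx G.
have GE : G = block_mx r 0 b G' by rewrite -[LHS]submxK G0.
have rE : r = (G ord0 ord0)%:M.
  rewrite [LHS]mx11_scalar; congr (_%:M); rewrite !mxE; congr (G _ _);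
  exact/val_inj.
set z := G ord0 ord0 in rE *.
set al := 1 + s%:C * `|z| ^+ 2.
have alR : al = (1 + s * (complex.Re z ^+ 2 + complex.Im z ^+ 2))%:C.
  by rewrite /al -add_Re2_Im2 [RHS]rmorphD rmorph1 rmorphM.
have al1 : 1 <= al.
  by rewrite lerDl mulr_ge0 ?ler0c// exprn_ge0.
have al0 : al != 0 by rewrite gt_eqF// (lt_le_trans ltr01).
have adjz : adjmx (z%:M : 'M[C]_1) = (conjc z)%:M.
  by apply/matrixP => i j; rewrite !ord1 !mxE !mulr1n.
have -> : gram_det s G = al *
    \det ((1%:M + s%:C *: (G' *m adjmx G')) + (s%:C / al) *: (b *m adjmx b)).
  rewrite /gram_det GE adjmx_block adjmx0 mulmx_block !mul0mx !mulmx0 !addr0.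
  rewrite scale_block_mx (@scalar_mx_block _ 1 m) add_block_mx !add0r.
  rewrite rE adjz -scalar_mxM -sqr_normc mul_mx_scalar mul_scalar_mx.
  rewrite [s%:C *: (_ %:M)]scale_scalar_mx -raddfD/= -/al.
  set L := block_mx (1%:M : 'M[C]_1) 0 (- (al^-1 * (s%:C * conjc z)) *: b) (1%:M : 'M[C]_m).
  set M := block_mx _ _ _ _.
  have <- : \det (L *m M) = \det M by rewrite det_mulmx det_lblock !det1 !mul1r.
  rewrite mulmx_block !mul1mx !mul0mx !addr0.
  have -> : - (al^-1 * (s%:C * conjc z)) *: b *m al%:M + s%:C *: (conjc z *: b) = 0.
    rewrite mul_mx_scalar !scalerA mulrN mulrA divff// mul1r.
    by rewrite -scalerDl addNr scale0r.
  rewrite det_ublock det_scalar1; congr (_ * \det _).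
  rewrite scalerDr addrC -addrA [_ *: (b *m _) + _]addrC -!addrA; congr (_ + (_ + _)).
  rewrite -scalemxAl -!scalemxAr !scalerA -scalerDl; congr (_ *: _).
  have alE : al = 1 + s%:C * (z * conjc z) by rewrite /al sqr_normc.
  move: (conjc z) (s%:C) alE al0 => w t -> al0; field.
  exact: al0.
have e0 : 0 <= s / (1 + s * (complex.Re z ^+ 2 + complex.Im z ^+ 2)).
  by rewrite divr_ge0// addr_ge0// mulr_ge0// addr_ge0// sqr_ge0.
have [q q0] := det_rank_one G' s0 b e0.
have -> : (s / (1 + s * (complex.Re z ^+ 2 + complex.Im z ^+ 2)))%:C = s%:C / al.
  by rewrite alR rmorphM fmorphV.
move=> ->.
rewrite ler_pM2l ?(lt_le_trans ltr01)// ler_peMr ?(le_trans ler01 (gram_det_ge1 _ s0))//.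
rewrite lerDl mulr_ge0// divr_ge0 ?ler0c// (le_trans ler01)//.
Qed.

Lemma gram_det_real s m n (G : 'M[C]_(m, n)) : 0 <= s ->
  gram_det s G = (complex.Re (gram_det s G))%:C /\ 1 <= complex.Re (gram_det s G).
Proof.
move=> s0; have := gram_det_ge1 G s0; rewrite lecE /= => /andP[/eqP I0 ge1].
by split=> //; case: (gram_det s G) I0 => x y /= ->.
Qed.

End gram.

(** * Diagonalization by the discrete Fourier transform *)

Lemma det_mxsub_bij (F : comNzRingType) m n (f : 'I_m -> 'I_n) (A : 'M[F]_n) :
  bijective f -> \det (mxsub f f A) = \det A.
Proof.
move=> bf; have mn : m = n by have := bij_eq_card bf; rewrite !card_ord.
subst m; pose s := perm (bij_inj bf).
have -> : mxsub f f A = row_perm s (col_perm s A).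
  by apply/matrixP => i j; rewrite !mxE !permE.
rewrite row_permE col_permE !det_mulmx mulrCA !det_perm -signr_addb.
by rewrite odd_permV addbb expr0 mulr1.
Qed.

Lemma det_mxdiag (F : comNzRingType) n (p : 'I_n -> nat)
    (B : forall i, 'M[F]_(p i)) :
  \det (\mxdiag_i B i) = \prod_i \det (B i).
Proof.
elim: n => [|n IH] in p B *.
  rewrite [RHS]big_ord0; suff E k (A : 'M[F]_k) : k = 0%N -> \det A = 1.
    by apply: E; rewrite big_ord0.
  by move=> k0; subst k; rewrite det_mx00.
rewrite mxdiag_recl [RHS]big_ord_recl -IH.
suff E k l (e : k = l) (A : 'M[F]_k) : \det (castmx (e, e) A) = \det A.
  by rewrite E det_ublock.
by subst l; rewrite castmx_id.
Qed.

(** Exchanging the two levels of indices, block number and position inside the block, makes a matrix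
    of diagonal blocks block diagonal. The same permutation acts on rows and columns, so the sign
    cancels. *)
Lemma det_mxblock_diag (F : comNzRingType) a b (M : 'I_b -> 'M[F]_a) :
  \det (\mxblock_(i < a, j < a) diag_mx (\row_(t < b) M t i j)) =
  \prod_t \det (M t).
Proof.
rewrite -det_mxdiag.
pose f (x : 'I_(\sum_(t < b) a)) : 'I_(\sum_(i < a) b) :=
  @tagnat.Rank a (fun=> b) (tagnat.sig2 x) (tagnat.sig1 x).
pose g (x : 'I_(\sum_(i < a) b)) : 'I_(\sum_(t < b) a) :=
  @tagnat.Rank b (fun=> a) (tagnat.sig2 x) (tagnat.sig1 x).
have R2 p q (i : 'I_p) (j : 'I_q) : tagnat.sig2 (@tagnat.Rank p (fun=> q) i j) = j.
  by apply/val_inj; rewrite tagnat.Rank2K.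
have fg : cancel f g.
  by move=> x; rewrite /f /g R2 tagnat.Rank1K tagnat.sig2K.
have gf : cancel g f.
  by move=> x; rewrite /f /g R2 tagnat.Rank1K tagnat.sig2K.
rewrite -(det_mxsub_bij _ (Bijective fg gf)); congr (\det _).
apply/matrixP => x y; rewrite !mxE /f !tagnat.Rank1K !R2.
by case: eqP => [->|_]; rewrite ?conform_mx_id ?mulr1n ?mulr0n ?mxE.
Qed.

Section dft.
Context (R : rcfType).
Notation C := R[i].

(** [X^n - 1] splits and is separable, so there are [n] distinct [n]-th roots of unity, and one of
    them is primitive. *)
Lemma complex_prim_root n : (0 < n)%N -> exists w : C, n.-primitive_root w.
Proof.
move=> n0; pose p : {poly C} := 'X^n - 1; have [r Dp] := closed_field_poly_normal p.
rewrite (monicP _) ?monicXnsubC // scale1r in Dp.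
have rn1 : all n.-unity_root r by apply/allP=> z; rewrite -root_prod_XsubC -Dp.
have sz_r : (n < (size r).+1)%N.
  by rewrite -(size_prod_XsubC r id) -Dp size_XnsubC.
have [|z _ hz] := hasP (has_prim_root n0 rn1 _ sz_r); last by exists z.
by rewrite -separable_prod_XsubC -Dp separable_Xn_sub_1 // pnatr_eq0 -lt0n.
Qed.

Lemma adjmx_mxblock p q (p_ : 'I_p -> nat) (q_ : 'I_q -> nat)
    (B : forall i j, 'M[C]_(p_ i, q_ j)) :
  adjmx (\mxblock_(i, j) B i j) = \mxblock_(j, i) adjmx (B i j).
Proof. by apply/matrixP => x y; rewrite !mxE. Qed.

Lemma mxdiag_unitary p n (U : 'M[C]_n) : U *m adjmx U = 1%:M ->
  (\mxdiag_(i < p) U) *m adjmx (\mxdiag_(i < p) U) = 1%:M.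
Proof.
move=> U1; rewrite {2}/mxdiag adjmx_mxblock mul_mxdiag_mxblock -mxdiagZ /mxdiag.
apply: eq_mxblock => i j; rewrite eq_sym.
by case: eqP => _; rewrite ?conform_mx_id ?adjmx0 ?mulmx0.
Qed.

Lemma gram_det_unitaryl (s : R) m n (U : 'M[C]_m) (G : 'M[C]_(m, n)) :
  U *m adjmx U = 1%:M -> gram_det s (U *m G) = gram_det s G.
Proof.
move=> U1; rewrite /gram_det adjmxM.
have -> : 1%:M + s%:C *: (U *m G *m (adjmx G *m adjmx U)) =
    U *m (1%:M + s%:C *: (G *m adjmx G)) *m adjmx U.
  by rewrite mulmxDr mulmx1 mulmxDl U1 -scalemxAr -scalemxAl !mulmxA.
by rewrite !det_mulmx mulrAC -det_mulmx U1 det1 mul1r.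
Qed.

Lemma diag_adjmx n (a b : 'rV[C]_n) :
  diag_mx a *m adjmx (diag_mx b) = diag_mx (\row_t (a ord0 t * conjc (b ord0 t))).
Proof.
have -> : adjmx (diag_mx b) = diag_mx (map_mx conjc b).
  by rewrite /adjmx tr_diag_mx map_diag_mx.
by rewrite mulmx_diag; congr diag_mx; apply/rowP => t; rewrite !mxE.
Qed.

Variables (n : nat) (w : C).
Hypotheses (n0 : (0 < n)%N) (wP : n.-primitive_root w).

Lemma prim_root_norm1 : `|w| = 1.
Proof.
apply/eqP; rewrite -(pexpr_eq1 n0 (normr_ge0 w)).
by rewrite -normrX (prim_expr_order wP) normr1.
Qed.

Lemma conjc_prim_root : conjc w = w^-1.
Proof.
have w0 : w != 0 by rewrite -normr_eq0 prim_root_norm1 oner_eq0.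
by apply: (mulfI w0); rewrite divff// -sqr_normc prim_root_norm1 expr1n.
Qed.

Lemma dft_orthogonal (r s : 'I_n) :
  \sum_(k < n) w ^+ (r * k) * w^-1 ^+ (s * k) = n%:R * (r == s)%:R.
Proof.
have w0 : w != 0 by rewrite -normr_eq0 prim_root_norm1 oner_eq0.
pose z := w ^+ r / w ^+ s.
have zE k : w ^+ (r * k) * w^-1 ^+ (s * k) = z ^+ k.
  by rewrite /z exprMn !exprVn -!exprM.
under eq_bigr do rewrite zE.
have [rs|rs] := eqVneq r s.
  rewrite mulr1 /z rs divff ?expf_neq0//.
  under eq_bigr do rewrite expr1n.
  by rewrite sumr_const card_ord.
have z1 : z != 1.
  apply: contra rs => /eqP /(congr1 (fun x => x * w ^+ s)).
  rewrite /z mulfVK ?expf_neq0// mul1r => /eqP.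
  by rewrite (eq_prim_root_expr wP) !modn_small.
rewrite mulr0; apply: (mulfI (_ : z - 1 != 0)); first by rewrite subr_eq0.
rewrite -subrX1 mulr0 /z exprMn exprVn -!exprM ![(_ * n)%N]mulnC !exprM.
by rewrite (prim_expr_order wP) !expr1n divr1 subrr.
Qed.

Let q : R := (Num.sqrt n%:R)^-1.

Let q2n : q%:C * q%:C * n%:R = 1.
Proof.
rewrite -rmorphM -(rmorph_nat (real_complex R)) -rmorphM/= /q -expr2 exprVn.
by rewrite sqr_sqrtr ?ler0n// mulVf// pnatr_eq0 -lt0n.
Qed.

Definition dft_mx : 'M[C]_n := \matrix_(r, s) (q%:C * w ^+ (r * s)).

Lemma dft_unitary : dft_mx *m adjmx dft_mx = 1%:M.
Proof.
apply/matrixP => r s; rewrite !mxE.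
transitivity (q%:C * q%:C * \sum_(k < n) w ^+ (r * k) * w^-1 ^+ (s * k)).
  rewrite big_distrr/=; apply: eq_bigr => k _.
  rewrite adjmxE !mxE.
  have -> : conjc (q%:C * w ^+ (s * k)) = q%:C * w^-1 ^+ (s * k).
    by rewrite -conjc_prim_root [LHS]rmorphM/= -rmorphXn/= oppr0.
  by rewrite mulrACA.
by rewrite dft_orthogonal mulrA q2n mul1r.
Qed.

(** The blocks depend on [r + s], not on [r - s], hence the same Fourier matrix on both sides
    instead of its adjoint on one: with [j = r + s] the summand becomes [h j w^(j u) w^((t - u) r)],
    and the sum over [r] forces [t = u]. *)
Lemma dft_hankel (h : 'I_n -> C) :
  dft_mx *m Htilde_blk h *m dft_mx =
  diag_mx (\row_t \sum_(j < n) h j * w ^+ (j * t)).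
Proof.
have w0 : w != 0 by rewrite -normr_eq0 prim_root_norm1 oner_eq0.
apply/matrixP => t u; rewrite -mulmxA !mxE.
transitivity (\sum_(r < n) \sum_(j < n)
   (q%:C * q%:C) * (h j * w ^+ (j * u) * (w ^+ (t * r) * w^-1 ^+ (u * r)))).
  apply: eq_bigr => r _; rewrite !mxE big_distrr/=.
  pose sh (s : 'I_n) := addmod r s.
  have shI : injective sh.
    move=> s s' /(congr1 val)/= /eqP; rewrite eqn_modDl !modn_small//.
    by move=> /eqP; exact: val_inj.
  rewrite [RHS](reindex_inj shI)/=; apply: eq_bigr => s _.
  rewrite !mxE -/(sh s).
  have -> : w ^+ ((r + s) %% n * u) = w ^+ (u * r) * w ^+ (s * u).
    rewrite exprM (prim_expr_mod wP) -exprM mulnDl exprD; congr (_ ^+ _ * _).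
    exact: mulnC.
  have wu : w ^+ (u * r) * w^-1 ^+ (u * r) = 1.
    by rewrite -exprMn divff// expr1n.
  transitivity (q%:C * q%:C * (h (sh s) * w ^+ (s * u) * w ^+ (t * r)) *
     (w ^+ (u * r) * w^-1 ^+ (u * r))); last by ring.
  by rewrite wu; ring.
rewrite exchange_big/=.
transitivity (\sum_(j < n) (q%:C * q%:C * n%:R) * (h j * w ^+ (j * u)) * (t == u)%:R).
  apply: eq_bigr => j _; rewrite -!big_distrr/= dft_orthogonal; ring.
rewrite q2n; case: eqP => [->|_].
  by rewrite mulr1n; apply: eq_bigr => j _; rewrite mul1r mulr1.
by rewrite mulr0n big1// => j _; rewrite mulr0.
Qed.

Lemma gram_det_Htilde (s : R) K nR (h : 'I_K -> 'I_nR -> 'I_n -> C) :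
  gram_det s (Htilde h) =
  \prod_(t < n) gram_det s (\matrix_(i < nR, k < K) \sum_(j < n) h k i j * w ^+ (j * t)).
Proof.
rewrite -(@gram_det_unitaryl s _ _ (\mxdiag_(i < nR) dft_mx) (Htilde h)); last first.
  exact/mxdiag_unitary/dft_unitary.
rewrite -(@gram_det_unitary _ s _ _ _ (\mxdiag_(k < K) dft_mx)); last first.
  exact/mxdiag_unitary/dft_unitary.
rewrite /Htilde mul_mxdiag_mxblock mul_mxblock_mxdiag.
under eq_mxblock do rewrite dft_hankel.
rewrite /gram_det adjmx_mxblock mul_mxblock.
rewrite -(@det_mxblock_diag C nR n (fun t => 1%:M + s%:C *:
  (\matrix_(i < nR, k < K) (\sum_(j < n) h k i j * w ^+ (j * t)) *m
   adjmx (\matrix_(i < nR, k < K) (\sum_(j < n) h k i j * w ^+ (j * t)))))).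
congr (\det _); apply/matrixP => x y; rewrite !mxE summxE.
have eqxy : (x == y) = (tagnat.sig1 x == tagnat.sig1 y) && (tagnat.sig2 x == tagnat.sig2 y).
  rewrite -[x in LHS]tagnat.sig2K -[y in LHS]tagnat.sig2K.
  by rewrite -[LHS]val_eqE tagnat.eq_Rank.
rewrite eqxy; have [xy|xy] := eqVneq (tagnat.sig2 x) (tagnat.sig2 y); last first.
  rewrite andbF mulr0n add0r big1 ?mulr0// => k _.
  by rewrite diag_adjmx !mxE (negPf xy) mulr0n.
rewrite andbT mulr1n; congr (_ + _ * _); apply: eq_bigr => k _.
by rewrite diag_adjmx !mxE xy eqxx mulr1n.
Qed.

End dft.

(** * Gram determinants of Gaussian matrices *)

Section complex_measurable.
Context (R : realType) d (T : measurableType d).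
Notation C := R[i].

Definition cmeasurable (h : T -> C) : Prop :=
  measurable_fun setT (fun x => complex.Re (h x)) /\
  measurable_fun setT (fun x => complex.Im (h x)).

Lemma cmeasurable_cst (c : C) : cmeasurable (fun=> c).
Proof. by split; exact: measurable_cst. Qed.

Lemma cmeasurableD (f g : T -> C) : cmeasurable f -> cmeasurable g ->
  cmeasurable (fun x => f x + g x).
Proof.
move=> [f1 f2] [g1 g2]; split.
- apply: (eq_measurable_fun (fun x => complex.Re (f x) + complex.Re (g x))).
    by move=> x _; case: (f x) (g x) => [? ?] [? ?].
  exact: measurable_funD.
- apply: (eq_measurable_fun (fun x => complex.Im (f x) + complex.Im (g x))).
    by move=> x _; case: (f x) (g x) => [? ?] [? ?].
  exact: measurable_funD.
Qed.

Lemma cmeasurableM (f g : T -> C) : cmeasurable f -> cmeasurable g ->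
  cmeasurable (fun x => f x * g x).
Proof.
move=> [f1 f2] [g1 g2]; split.
- apply: (eq_measurable_fun (fun x => complex.Re (f x) * complex.Re (g x)
     - complex.Im (f x) * complex.Im (g x))).
    by move=> x _; case: (f x) (g x) => [? ?] [? ?].
  by apply: measurable_funB; apply: measurable_funM.
- apply: (eq_measurable_fun (fun x => complex.Re (f x) * complex.Im (g x)
     + complex.Im (f x) * complex.Re (g x))).
    by move=> x _; case: (f x) (g x) => [? ?] [? ?].
  by apply: measurable_funD; apply: measurable_funM.
Qed.

Lemma cmeasurable_conj (f : T -> C) : cmeasurable f ->
  cmeasurable (fun x => conjc (f x)).
Proof.
move=> [f1 f2]; split.
- apply: (eq_measurable_fun (fun x => complex.Re (f x))) => //.
  by move=> x _; case: (f x).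
- apply: (eq_measurable_fun (fun x => - complex.Im (f x))).
    by move=> x _; case: (f x).
  exact: (measurableT_comp (f:=-%R : R -> R)).
Qed.

Lemma cmeasurable_sum (I : Type) (r : seq I) (f : I -> T -> C) :
  (forall i, cmeasurable (f i)) -> cmeasurable (fun x => \sum_(i <- r) f i x).
Proof.
move=> mf; elim: r => [|i r IH].
  have -> : (fun x => \sum_(i <- [::]) f i x) = fun=> 0.
    by apply/funext => x; rewrite big_nil.
  exact: cmeasurable_cst.
have -> : (fun x => \sum_(j <- i :: r) f j x) = fun x => f i x + \sum_(j <- r) f j x.
  by apply/funext => x; rewrite big_cons.
exact: cmeasurableD.
Qed.

Lemma cmeasurable_prod (I : Type) (r : seq I) (f : I -> T -> C) :
  (forall i, cmeasurable (f i)) -> cmeasurable (fun x => \prod_(i <- r) f i x).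
Proof.
move=> mf; elim: r => [|i r IH].
  have -> : (fun x => \prod_(i <- [::]) f i x) = fun=> 1.
    by apply/funext => x; rewrite big_nil.
  exact: cmeasurable_cst.
have -> : (fun x => \prod_(j <- i :: r) f j x) = fun x => f i x * \prod_(j <- r) f j x.
  by apply/funext => x; rewrite big_cons.
exact: cmeasurableM.
Qed.

Definition log_gram_det (s : R) m n (G : 'M[C]_(m, n)) : R :=
  ln (complex.Re (gram_det s G)).

Lemma measurable_log_gram_det (s : R) m n (G : T -> 'M[C]_(m, n)) :
  (forall i j, cmeasurable (fun x => G x i j)) ->
  measurable_fun setT (fun x => log_gram_det s (G x)).
Proof.
move=> mG; apply: (measurableT_comp (@measurable_ln R)).
suff [] : cmeasurable (fun x => gram_det s (G x)) by [].
rewrite /gram_det /determinant; apply: cmeasurable_sum => sg.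
apply: cmeasurableM; first exact: cmeasurable_cst.
apply: cmeasurable_prod => i.
have -> : (fun x => (1%:M + s%:C *: (G x *m adjmx (G x))) i (sg i)) =
   fun x => (i == sg i)%:R + s%:C * \sum_k G x i k * conjc (G x (sg i) k).
  apply/funext => x; rewrite !mxE; congr (_ + _ * _); apply: eq_bigr => k _.
  by rewrite adjmxE.
apply: cmeasurableD; first exact: cmeasurable_cst.
apply: cmeasurableM; first exact: cmeasurable_cst.
apply: cmeasurable_sum => k; apply: cmeasurableM => //.
exact: cmeasurable_conj.
Qed.

End complex_measurable.

Lemma log_gram_det_ge0 (R : realType) (s : R) m n (G : 'M[R[i]]_(m, n)) :
  0 <= s -> 0 <= log_gram_det s G.
Proof. by move=> s0; apply: ln_ge0; have [] := gram_det_real G s0. Qed.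

Lemma gaussian_family_sub (R : realType) d (Omega : measurableType d)
    (P : probability Omega R) (I J : finType) (phi : J -> I) (X : I -> Omega -> R) :
  injective phi -> gaussian_family P X -> gaussian_family P (fun j => X (phi j)).
Proof.
move=> phiI [iX nX]; split=> [B mB|j]; last exact: nX.
(* The box is extended by the full line at the indices outside the image of [phi]. *)
pose A i := if [pick j | phi j == i] is Some j then B j else setT.
have Aphi j : A (phi j) = B j.
  rewrite /A; case: pickP => [j' /eqP/phiI ->//|/(_ j)].
  by rewrite eqxx.
have AN i : i \notin codom phi -> A i = setT.
  move=> ni; rewrite /A; case: pickP => [j /eqP ji|//].
  by case/negP: ni; rewrite -ji codom_f.
have mA i : measurable (A i).
  by rewrite /A; case: pickP => // _ _; exact: measurableT.
have := iX A mA.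
rewrite (_ : \bigcap_i (X i @^-1` A i) = \bigcap_j (X (phi j) @^-1` B j)).
  move=> ->; rewrite (bigID [in codom phi])/= [X in (_ * X)%E]big1 ?mule1; last first.
    by move=> i ni; rewrite AN// preimage_setT probability_setT.
  rewrite -big_uniq/=; last by rewrite map_inj_uniq ?enum_uniq.
  by rewrite big_image/=; apply: eq_bigr => j _; rewrite Aphi.
apply/seteqP; split=> w wA.
  by move=> j _; have /= := wA (phi j) Logic.I; rewrite Aphi.
move=> i _ /=; have [/codomP[j ->]|ni] := boolP (i \in codom phi).
  by rewrite Aphi; exact: wA.
by rewrite AN.
Qed.

(** * Row-by-row induction on a Gaussian matrix *)

Section rows.
Context (R : realType).
Notation C := R[i].

Definition rows_mx m n (v : 'I_m -> 'rV[C]_n) : 'M[C]_(m, n) :=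
  \matrix_(i, j) v i ord0 j.

Lemma rows_mxM m n p (v : 'I_m -> 'rV[C]_n) (U : 'M[C]_(n, p)) :
  rows_mx v *m U = rows_mx (fun i => v i *m U).
Proof.
by apply/matrixP => i j; rewrite !mxE; apply: eq_bigr => k _; rewrite !mxE.
Qed.

Lemma log_gram_det_schur (s : R) m n (v : 'I_m.+1 -> 'rV[C]_n.+1) (U : 'M[C]_n.+1) :
  0 < s -> U *m adjmx U = 1%:M ->
  (forall j, j != ord0 -> (v ord0 *m U) ord0 j = 0) ->
  ln (1 + s * \sum_(c : 'I_n.+1 * bool) part c.2 (v ord0 ord0 c.1) ^+ 2) +
  log_gram_det s (rows_mx (fun i => \row_j (v (lift ord0 i) *m U) ord0 (lift ord0 j)))
  <= log_gram_det s (rows_mx v).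
Proof.
move=> s0 U1 vU.
set T := \sum_c _; set G' := rows_mx _.
have T0 : 0 <= T by apply: sumr_ge0 => c _; exact: sqr_ge0.
pose G : 'M[C]_(1 + m, 1 + n) := rows_mx v *m U.
have ur0 : ursubmx G = 0.
  apply/matrixP => i j; rewrite !ord1 !mxE -[RHS](vU (rshift 1 j))//.
  rewrite mxE; apply: eq_bigr => k _; rewrite mxE; congr (v _ _ _ * _).
  exact/val_inj.
have dr : drsubmx G = G'.
  apply/matrixP => i j; rewrite 2![LHS]mxE.
  rewrite (_ : G = rows_mx (fun i => v i *m U)); last exact: rows_mxM.
  rewrite !mxE; apply: eq_bigr => k _; congr (v _ _ _ * U _ _); exact/val_inj.
(* The corner is the only nonzero entry of the first row of [G], and [U] preserves the norm of that
   row. *)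
have G00 : `|G ord0 ord0| ^+ 2 = T%:C.
  rewrite sqr_normc.
  have vv : (v ord0 *m U) *m adjmx (v ord0 *m U) = v ord0 *m adjmx (v ord0).
    by rewrite adjmxM mulmxA -(mulmxA (v ord0)) U1 mulmx1.
  have GE : G ord0 ord0 = (v ord0 *m U) ord0 ord0.
    by rewrite (_ : G = rows_mx (fun i => v i *m U)) ?mxE//; exact: rows_mxM.
  have := congr1 (fun A : 'M[C]_1 => A ord0 ord0) vv.
  rewrite mxE (bigD1 ord0)//= big1 ?addr0; last first.
    by move=> j j0; rewrite vU// mul0r.
  rewrite adjmxE -GE => ->; rewrite mxE /T rmorph_sum/=.
  rewrite -(pair_bigA _ (fun j b => (part b (v ord0 ord0 j) ^+ 2)%:C))/=.
  apply: eq_bigr => j _; rewrite adjmxE -sqr_normc -add_Re2_Im2 /part.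
  by rewrite big_bool/= addrC rmorphD.
have := gram_det_schur (ltW s0) ur0; rewrite dr G00.
have -> : gram_det s G = gram_det s (rows_mx v) by exact: gram_det_unitary.
have [E' ge1'] := gram_det_real G' (ltW s0).
have [E ge1] := gram_det_real (rows_mx v) (ltW s0).
have -> : 1 + s%:C * T%:C = (1 + s * T)%:C by rewrite [RHS]rmorphD rmorph1 rmorphM.
rewrite E' E -rmorphM lecR => le.
have a0 : 0 < 1 + s * T by rewrite ltr_pwDl// mulr_ge0// ltW.
rewrite /log_gram_det -lnM ?posrE// ?(lt_le_trans ltr01)//.
by rewrite ler_ln// posrE ?mulr_gt0// ?(lt_le_trans ltr01).
Qed.

Lemma measurable_rows d (Omega : measurableType d) (P : probability Omega R)
    (s : R) m n (Z : 'I_m -> Omega -> 'rV[C]_n) :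
  gaussian_rows P Z ->
  measurable_fun setT (fun w => log_gram_det s (rows_mx (Z ^~ w))).
Proof.
move=> [_ nZ]; apply: measurable_log_gram_det => i j; split.
- apply: (eq_measurable_fun (fun w => part false (Z i w ord0 j))).
    by move=> w _; rewrite mxE.
  exact: (nZ (i, j, false)).1.
- apply: (eq_measurable_fun (fun w => part true (Z i w ord0 j))).
    by move=> w _; rewrite mxE.
  exact: (nZ (i, j, true)).1.
Qed.

Lemma gram_rows_bound (s : R) m : 0 < s ->
  forall n d (Omega : measurableType d) (P : probability Omega R)
    (Z : 'I_m -> Omega -> 'rV[C]_n),
  (m <= n)%N -> gaussian_rows P Z ->
  ((\sum_(1 <= l < m.+1) ln (1 + s * expR (Hsum R (n - l) - euler_gamma)))%:E <=
   \int[P]_w (log_gram_det s (rows_mx (Z ^~ w)))%:E)%E.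
Proof.
move=> s0; elim: m => [|m IH] n d Omega P Z mn gZ.
  rewrite big_geq//; apply: integral_ge0 => w _.
  by rewrite lee_fin log_gram_det_ge0// ltW.
case: n => // n in Z mn gZ *.
pose I := ('I_m.+1 * 'I_n.+1 * bool)%type.
pose X (c : I) w := part c.2 (Z c.1.1 w ord0 c.1.2).
have gX : gaussian_family P X := gZ.
have mX c := (gX.2 c).1.
pose family := g_sigma_algebraType (@cylinders R I).
pose G (x : family) : 'M[C]_(m.+1, n.+1) :=
  \matrix_(i, j) (x (i, j, false) +i* x (i, j, true)).
pose F (x : family) : \bar R := (log_gram_det s (G x))%:E.
have mF : measurable_fun setT F.
  apply/measurable_EFinP/measurable_log_gram_det => i j; split.
  - apply: (eq_measurable_fun (fun x : family => x (i, j, false))).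
      by move=> x _; rewrite mxE.
    exact: measurable_coord.
  - apply: (eq_measurable_fun (fun x : family => x (i, j, true))).
      by move=> x _; rewrite mxE.
    exact: measurable_coord.
have F0 x : (0 <= F x)%E by rewrite lee_fin log_gram_det_ge0// ltW.
pose D (c : I) := c.1.1 == ord0.
have gX2 := gaussian_family_split D gX gX.
(* The first row is read on the first copy of [Omega], all other rows on the second. *)
pose V (z : Omega * Omega) i := if i == ord0 then Z i z.1 else Z i z.2.
pose X2 (z : Omega * Omega) : family := fun c => if D c then X c z.1 else X c z.2.
have FX2 z : F (X2 z) = (log_gram_det s (rows_mx (V z)))%:E.
  congr ((log_gram_det s _)%:E); apply/matrixP => i j; rewrite !mxE /X2 /D /V /X/=.
  by case: (i == ord0) => /=; [case: (Z i z.1 ord0 j)|case: (Z i z.2 ord0 j)].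
have -> : (\int[P]_w (log_gram_det s (rows_mx (Z ^~ w)))%:E =
    \int[P \x P]_z F (X2 z))%E.
  rewrite -[RHS](gaussian_family_law gX gX2 mF F0); apply: eq_integral => w _.
  congr ((log_gram_det s _)%:E); apply/matrixP => i j; rewrite !mxE /X/=.
  by case: (Z i w ord0 j).
have mX2 : measurable_fun setT (fun z => F (X2 z)).
  apply: (measurableT_comp mF); apply: measurable_family => c.
  exact: (gX2.2 c).1.
rewrite (@fubini_tonelli1 _ _ _ _ _ P P (fun z => F (X2 z)) mX2 (fun=> F0 _)).
set B := \sum_(1 <= l < m.+1) ln (1 + s * expR (Hsum R (n - l) - euler_gamma)).
have B0 : 0 <= B.
  apply: sumr_ge0 => l _; apply: ln_ge0.
  by rewrite lerDl mulr_ge0 ?expR_ge0 ?ltW.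
pose N w := \sum_(c : 'I_n.+1 * bool) part c.2 (Z ord0 w ord0 c.1) ^+ 2.
have N0 w : 0 <= N w by apply: sumr_ge0 => c _; exact: sqr_ge0.
have L0 w : 0 <= ln (1 + s * N w) by rewrite ln_ge0// lerDl mulr_ge0// ltW.
have cstI (a : R) : (\int[P]_w (cst a%:E) w = a%:E)%E.
  by rewrite integral_cst// [X in (_ * X)%E](probability_setT P) mule1.
(* With [w1] fixed, [U] is a constant matrix, so the remaining rows times [U] are still Gaussian;
   dropping their first column leaves the matrix of the induction hypothesis. *)
have inner w1 : ((ln (1 + s * N w1))%:E + B%:E <= fubini_F P (fun z => F (X2 z)) w1)%E.
  have [U [[U1 gU] vU]] := gaussian_unitary_exists (Z ord0 w1).
  pose Z' (i : 'I_m) w : 'rV[C]_n := \row_j (Z (lift ord0 i) w *m U) ord0 (lift ord0 j).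
  have gZ' : gaussian_rows P Z'.
    pose phi (c : 'I_m * 'I_n * bool) : I := (lift ord0 c.1.1, lift ord0 c.1.2, c.2).
    have phiI : injective phi.
      move=> [[i j] b] [[i' j'] b'] E; congr (_, _, _).
      - exact: (lift_inj (congr1 (fun c : I => c.1.1) E)).
      - exact: (lift_inj (congr1 (fun c : I => c.1.2) E)).
      - exact: (congr1 (fun c : I => c.2) E).
    have := gaussian_family_sub phiI (gU _ _ _ _ _ gZ).
    by congr (gaussian_family P _); apply/funext => c; apply/funext => w /=; rewrite [Z' _ _ _ _]mxE.
  have mL := measurable_rows s gZ'.
  have le w2 : ((ln (1 + s * N w1))%:E + (log_gram_det s (rows_mx (Z' ^~ w2)))%:E
      <= F (X2 (w1, w2)))%E.
    rewrite FX2 -EFinD lee_fin.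
    exact: (@log_gram_det_schur s m n (V (w1, w2)) U s0 U1).
  apply: (@le_trans _ _ (\int[P]_w2 ((ln (1 + s * N w1))%:E +
      (log_gram_det s (rows_mx (Z' ^~ w2)))%:E))%E); last first.
    apply: ge0_le_integral.
    - exact: measurableT.
    - by move=> w _; rewrite adde_ge0// lee_fin ?log_gram_det_ge0// ltW.
    - apply: emeasurable_funD => //.
      exact/measurable_EFinP.
    - by apply: (measurableT_comp mX2); exact: measurable_pair1.
    - by move=> w _; exact: le.
  rewrite ge0_integralD//; last 3 first.
  - by move=> w _; rewrite lee_fin.
  - by move=> w _; rewrite lee_fin log_gram_det_ge0// ltW.
  - exact/measurable_EFinP.
  by rewrite cstI leeD2l//; exact: IH.
have gN : gaussian_family P (fun (c : 'I_n.+1 * bool) w => part c.2 (Z ord0 w ord0 c.1)).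
  apply: (@gaussian_family_sub R _ _ P I ('I_n.+1 * bool)%type
    (fun c => (ord0, c.1, c.2)) X _ gX).
  by move=> [j b] [j' b'] [-> ->].
have mN : measurable_fun setT (fun w => (ln (1 + s * N w))%:E).
  apply/measurable_EFinP; apply: (measurableT_comp (@measurable_ln R)).
  apply: measurable_funD => //; apply: measurable_funM => //.
  apply: measurable_sum => c; apply: (measurableT_comp (f:=fun x : R => x ^+ 2)).
    exact: exprn_measurable.
  exact: (gN.2 c).1.
apply: (@le_trans _ _ (\int[P]_w ((ln (1 + s * N w))%:E + B%:E))%E); last first.
  apply: ge0_le_integral.
  - exact: measurableT.
  - by move=> w _; rewrite adde_ge0// lee_fin.
  - exact: emeasurable_funD.
  - exact: (@measurable_fun_fubini_tonelli_F _ _ _ _ _ P (fun z => F (X2 z)) mX2 (fun=> F0 _)).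
  - by move=> w _; exact: inner.
rewrite ge0_integralD//; last by move=> w _; rewrite lee_fin.
(* The term [l = 1] comes from the first row, whose [n+1] complex entries give shape [n+1] and hence
   [H_n]. The terms [l >= 2] are those of the smaller matrix, shifted by one. *)
rewrite cstI big_ltn// subn1 /= EFinD.
have -> : \sum_(2 <= l < m.+2) ln (1 + s * expR (Hsum R (n.+1 - l) - euler_gamma)) = B.
  by rewrite /B big_add1; apply: eq_bigr => l _; rewrite subSS.
apply: leeD => //.
apply: (gaussian_ln_bound s0 gN).
by rewrite card_prod card_ord card_bool mulnC.
Qed.

End rows.

(** * Cyclic delay diversity *)

Lemma gram_det_rescale (R : rcfType) (s q : R) m n (G : 'M[R[i]]_(m, n)) :
  gram_det (s * q ^+ 2) G = gram_det s (q%:C *: G).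
Proof.
rewrite /gram_det adjmxZ conjc_real -scalemxAl -scalemxAr !scalerA.
by rewrite -mulrA -!rmorphM -expr2.
Qed.

Lemma ln_prod (R : realType) (I : Type) (r : seq I) (a : I -> R) :
  (forall i, 0 < a i) -> ln (\prod_(i <- r) a i) = \sum_(i <- r) ln (a i).
Proof.
move=> a0; elim: r => [|i r IH]; first by rewrite !big_nil ln1.
by rewrite !big_cons lnM ?posrE ?prodr_gt0// IH.
Qed.

Lemma log_gram_det_Htilde (R : realType) (s : R) (n K nR : nat) (om : R[i])
    (h : 'I_K -> 'I_nR -> 'I_n -> R[i]) :
  0 <= s -> (0 < n)%N -> n.-primitive_root om ->
  log_gram_det s (Htilde h) = \sum_(t < n) log_gram_det s
    (\matrix_(i < nR, k < K) \sum_(j < n) h k i j * om ^+ (j * t)).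
Proof.
move=> s0 n0 omP; rewrite /log_gram_det (gram_det_Htilde n0 omP).
rewrite -ln_prod; last first.
  by move=> t; apply: lt_le_trans ltr01 _; exact: (gram_det_real _ s0).2.
congr ln.
have -> // : \prod_(t < n) gram_det s
    (\matrix_(i < nR, k < K) \sum_(j < n) h k i j * om ^+ (j * t)) =
    (\prod_(t < n) complex.Re (gram_det s
      (\matrix_(i < nR, k < K) \sum_(j < n) h k i j * om ^+ (j * t))))%:C.
rewrite [RHS](rmorph_prod (real_complex R)); apply: eq_bigr => t _.
exact: (gram_det_real _ s0).1.
Qed.

Section channel.
Context (R : realType) d (Omega : measurableType d) (P : probability Omega R).
Notation C := R[i].

(* The smaller dimension indexes the rows, as the triangularization requires. *)
Lemma gram_matrix_bound (s : R) (nR K : nat) (y : 'I_K -> 'I_nR -> Omega -> C) :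
  0 < s ->
  gaussian_family P (fun (c : 'I_K * 'I_nR * bool) w => part c.2 (y c.1.1 c.1.2 w)) ->
  ((\sum_(1 <= l < (minn nR K).+1)
      ln (1 + s * expR (Hsum R (maxn nR K - l) - euler_gamma)))%:E <=
   \int[P]_w (log_gram_det s (\matrix_(i < nR, k < K) y k i w))%:E)%E.
Proof.
move=> s0 gy; have [le|lt] := leqP nR K.
  pose Z (i : 'I_nR) w : 'rV[C]_K := \row_k y k i w.
  have gZ : gaussian_rows P Z.
    pose phi (c : 'I_nR * 'I_K * bool) : 'I_K * 'I_nR * bool := (c.1.2, c.1.1, c.2).
    have phiI : injective phi by move=> [[i k] b] [[i' k'] b'] [-> -> ->].
    have := gaussian_family_sub phiI gy.
    by congr (gaussian_family P _); apply/funext => c; apply/funext => w /=; rewrite mxE.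
  apply: le_trans (gram_rows_bound s0 le gZ) _.
  rewrite le_eqVlt; apply/orP; left; apply/eqP.
  apply: eq_integral => w _; congr ((log_gram_det s _)%:E).
  by apply/matrixP => i k; rewrite !mxE.
pose Z (k : 'I_K) w : 'rV[C]_nR := \row_i y k i w.
have gZ : gaussian_rows P Z.
  move: gy; congr (gaussian_family P _); apply/funext => c; apply/funext => w /=.
  by rewrite mxE.
apply: le_trans (gram_rows_bound s0 (ltnW lt) gZ) _.
rewrite le_eqVlt; apply/orP; left; apply/eqP.
apply: eq_integral => w _; congr (_%:E); rewrite /log_gram_det -gram_det_tr.
by congr (ln (complex.Re (gram_det s _))); apply/matrixP => i k; rewrite !mxE.
Qed.

(** Up to the factor [sqrt (n+1)], the entries at frequency [t] are products of the Gaussian rows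
    with one fixed unit vector [u]. A unitary with first column proportional to [u] exhibits them,
    up to a common phase, as first coordinates of Gaussian rows, and the factor turns [s / (n+1)]
    into [s]. *)
Lemma dft_column_bound (s : R) (nR K n : nat) (om : C) (t : 'I_n.+1)
    (Z : 'I_K * 'I_nR -> Omega -> 'rV[C]_n.+1) :
  0 < s -> n.+1.-primitive_root om -> gaussian_rows P Z ->
  ((\sum_(1 <= l < (minn nR K).+1)
      ln (1 + s * expR (Hsum R (maxn nR K - l) - euler_gamma)))%:E <=
   \int[P]_w (log_gram_det (s / n.+1%:R) (\matrix_(i < nR, k < K)
      \sum_(j < n.+1) Z (k, i) w ord0 j * om ^+ (j * t)))%:E)%E.
Proof.
move=> s0 omP gZ.
pose q : R := (Num.sqrt n.+1%:R)^-1.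
have q2 : q ^+ 2 = n.+1%:R^-1 by rewrite exprVn sqr_sqrtr.
pose u : 'cV[C]_n.+1 := \col_j (q%:C * om ^+ (j * t)).
have [U [[U1 gU] vU]] := gaussian_unitary_exists (adjmx u).
pose r := (adjmx u *m U) ord0 ord0.
have vE : adjmx u *m U = r *: delta_mx ord0 ord0.
  apply/rowP => j; rewrite ![in RHS]mxE eqxx /=.
  have [->|j0] := eqVneq j ord0; first by rewrite mulr1.
  by rewrite mulr0 vU.
have uE : u = U *m (conjc r *: delta_mx ord0 ord0).
  have U2 : adjmx (adjmx u *m U) = adjmx U *m u by rewrite adjmxM adjmxK.
  have -> : conjc r *: delta_mx ord0 ord0 = adjmx (adjmx u *m U).
    rewrite vE adjmxZ; congr (_ *: _); apply/matrixP => i j.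
    by rewrite adjmxE !mxE andbC conjc_nat.
  by rewrite U2 mulmxA U1 mul1mx.
have om1 := prim_root_norm1 (ltn0Sn n) omP.
(* [|r|] is the norm of [u], a sum of [n+1] terms [1/(n+1)] under the square root because the powers
   of [om] have modulus 1. *)
have r1 : `|conjc r| = 1.
  apply/eqP; rewrite normcJ -(pexpr_eq1 (ltn0Sn 1) (normr_ge0 r)) sqr_normc; apply/eqP.
  have : (adjmx u *m U) *m adjmx (adjmx u *m U) = adjmx u *m u.
    by rewrite adjmxM mulmxA -(mulmxA (adjmx u)) U1 mulmx1 adjmxK.
  move=> /(congr1 (fun A : 'M[C]_1 => A ord0 ord0)).
  rewrite mxE (bigD1 ord0)//= big1 ?addr0; last first.
    by move=> j j0; rewrite vU// mul0r.
  rewrite adjmxE -/r => ->; rewrite mxE.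
  transitivity (\sum_(j < n.+1) (q ^+ 2)%:C).
    apply: eq_bigr => j _; rewrite adjmxE mulrC -sqr_normc mxE normrM normrX om1.
    rewrite expr1n mulr1 normc_def /= expr0n addr0 sqrtr_sqr -rmorphXn/=.
    by rewrite real_normK// num_real.
  by rewrite sumr_const card_ord q2 -rmorphMn/= -mulr_natr mulVf ?pnatr_eq0.
pose y (k : 'I_K) (i : 'I_nR) w : C := (Z (k, i) w *m U) ord0 ord0.
have gy : gaussian_family P
    (fun (c : 'I_K * 'I_nR * bool) w => part c.2 (y c.1.1 c.1.2 w)).
  pose phi (c : 'I_K * 'I_nR * bool) : 'I_K * 'I_nR * 'I_n.+1 * bool :=
    ((c.1.1, c.1.2), ord0, c.2).
  have phiI : injective phi by move=> [[k i] b] [[k' i'] b'] [-> -> ->].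
  exact: (gaussian_family_sub phiI (gU _ _ _ _ _ gZ)).
have key w : (conjc r *: \matrix_(i < nR, k < K) y k i w) = q%:C *:
    \matrix_(i < nR, k < K) \sum_(j < n.+1) Z (k, i) w ord0 j * om ^+ (j * t).
  apply/matrixP => i k; rewrite ![in LHS]mxE ![in RHS]mxE.
  transitivity ((Z (k, i) w *m u) ord0 ord0).
    rewrite uE mulmxA -scalemxAr [RHS]mxE; congr (_ * _).
    rewrite [RHS]mxE (bigD1 ord0)//= big1 ?addr0 => [|j j0].
      by rewrite [delta_mx _ _ _ _]mxE eqxx mulr1.
    by rewrite [delta_mx _ _ _ _]mxE (negPf j0) mulr0.
  rewrite mxE big_distrr/=; apply: eq_bigr => j _.
  by rewrite [u _ _]mxE mulrCA.
have logE (A B : 'M[C]_(nR, K)) : conjc r *: A = q%:C *: B ->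
    log_gram_det s A = log_gram_det (s / n.+1%:R) B.
  move=> AB; have Es : s / n.+1%:R = s * q ^+ 2 by rewrite q2.
  by rewrite /log_gram_det Es gram_det_rescale -AB gram_det_scale.
apply: le_trans (gram_matrix_bound s0 gy) _.
rewrite le_eqVlt; apply/orP; left; apply/eqP.
by apply: eq_integral => w _; rewrite (logE _ _ (key w)).
Qed.

End channel.

Unset Implicit Arguments.

Theorem theorem1 (R : realType) (d : measure_display) (Omega : measurableType d)
  (P : probability Omega R) (K nT nR : nat) (snr : R)
  (X : 'I_K * 'I_nR * 'I_nT * bool -> Omega -> R) :
  (1 <= K)%N -> (1 <= nT)%N -> (1 <= nR)%N -> 0 < snr ->
  mutually_independent P X ->
  (forall c, has_normal_law P (X c) 0 (Num.sqrt (2^-1))) ->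
  let h (w : Omega) (k : 'I_K) (i : 'I_nR) (j : 'I_nT) : R[i] :=
    Complex (X (k, i, j, false) w) (X (k, i, j, true) w) in
  let L := minn nR K in
  let M := maxn nR K in
  ((\sum_(1 <= l < L.+1)
       ln (1 + snr * expR (\sum_(1 <= k < (M - l).+1) (k%:R : R)^-1 - euler_gamma))
         / ln 2)%:E
   <= \int[P]_w (cdd_rate snr (h w))%:E)%E.
Proof.
case: nT X => // n X _ _ _ snr0 iX nX; lazy beta zeta.
set L := minn nR K; set M := maxn nR K.
pose h (w : Omega) (k : 'I_K) (i : 'I_nR) (j : 'I_n.+1) : R[i] :=
  Complex (X (k, i, j, false) w) (X (k, i, j, true) w).
have [om omP] := complex_prim_root R (ltn0Sn n).
pose Z (c : 'I_K * 'I_nR) w : 'rV[R[i]]_n.+1 := \row_j h w c.1 c.2 j.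
have gZ : gaussian_rows P Z.
  have : gaussian_family P X by split.
  congr (gaussian_family P _); apply/funext => -[[[k i] j] b]; apply/funext => w /=.
  by rewrite mxE /h /part; case: b.
pose G (t : 'I_n.+1) w :=
  \matrix_(i < nR, k < K) \sum_(j < n.+1) Z (k, i) w ord0 j * om ^+ (j * t).
pose g (t : 'I_n.+1) w := log_gram_det (snr / n.+1%:R) (G t w).
have sn0 : 0 <= snr / n.+1%:R by rewrite divr_ge0// ltW.
have ln20 : 0 < ln (2 : R) by rewrite ln_gt0// ltr1n.
(* The normalization by the block length [T = n+1], with the change from natural to binary
   logarithms. *)
pose c : R := n.+1%:R^-1 / ln 2.
have c0 : 0 <= c by rewrite divr_ge0 ?invr_ge0 ?ltW.
have rateE w : cdd_rate snr (h w) = \sum_(t < n.+1) c * g t w.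
  rewrite -big_distrr /=.
  transitivity (c * log_gram_det (snr / n.+1%:R) (Htilde (h w))).
    by rewrite /cdd_rate /c -mulrA; congr (_ * _); rewrite mulrC.
  apply: (congr1 (fun x => c * x)).
  apply: (etrans (log_gram_det_Htilde (h w) sn0 (ltn0Sn n) omP)).
  apply: eq_bigr => t _; rewrite /g.
  have -> // : G t w =
      \matrix_(i < nR, k < K) \sum_(j < n.+1) h w k i j * om ^+ (j * t).
  apply/matrixP => i k; rewrite [LHS]mxE [RHS]mxE.
  by apply: eq_bigr => j _; rewrite [Z _ _ _ _]mxE.
have mg t : measurable_fun setT (g t).
  apply: measurable_log_gram_det => i k.
  have -> : (fun w => G t w i k) =
      fun w => \sum_(j < n.+1) Z (k, i) w ord0 j * om ^+ (j * t).
    by apply/funext => w; rewrite mxE.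
  apply: cmeasurable_sum => j; apply: cmeasurableM; last exact: cmeasurable_cst.
  by split; [exact: (gZ.2 (k, i, j, false)).1|exact: (gZ.2 (k, i, j, true)).1].
have g0 t w : 0 <= g t w by exact: log_gram_det_ge0.
set B := \sum_(1 <= l < L.+1) ln (1 + snr * expR (Hsum R (M - l) - euler_gamma)).
(* Every frequency obeys the same bound [B]. By linearity of the expectation the [n+1] bounds simply
   add up, which cancels the factor [1/T]. *)
have gB t : (B%:E <= \int[P]_w (g t w)%:E)%E by exact: dft_column_bound.
have intE : (\int[P]_w (cdd_rate snr (h w))%:E =
    \sum_(t < n.+1) c%:E * \int[P]_w (g t w)%:E)%E.
  transitivity (\int[P]_w (\sum_(t < n.+1) (c * g t w)%:E))%E.
    by apply: eq_integral => w _; rewrite rateE sumEFin.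
  rewrite ge0_integral_sum; last 3 first.
  - exact: measurableT.
  - by move=> t; apply/measurable_EFinP; exact: measurable_funM.
  - by move=> t w _; rewrite lee_fin mulr_ge0.
  apply: eq_bigr => t _; rewrite -ge0_integralZl; last 4 first.
  - exact: measurableT.
  - exact/measurable_EFinP.
  - by move=> w _; rewrite lee_fin.
  - by rewrite lee_fin.
  by apply: eq_integral => w _; rewrite EFinM.
have sumE : (\sum_(1 <= l < L.+1)
    ln (1 + snr * expR (\sum_(1 <= k < (M - l).+1) (k%:R : R)^-1 - euler_gamma)) / ln 2)%:E
    = (\sum_(t < n.+1) c%:E * B%:E)%E.
  transitivity (B / ln 2)%:E; first by rewrite -big_distrl.
  rewrite -EFinM sumEFin sumr_const card_ord; congr (_%:E).
  have n1 : n.+1%:R != 0 :> R by rewrite pnatr_eq0.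
  rewrite -[RHS]mulr_natr /c; clear gB; clearbody B; move: (n.+1%:R : R) (ln 2 : R) n1 => x y x0.
  transitivity (x^-1 * x * (B / y)); first by rewrite mulVf// mul1r.
  by move: (x^-1) (y^-1) => x' y'; ring.
apply: (@le_trans _ _ (\sum_(t < n.+1) c%:E * B%:E)%E); first by rewrite sumE.
apply: (@le_trans _ _ (\sum_(t < n.+1) c%:E * \int[P]_w (g t w)%:E)%E); last first.
  by rewrite -intE.
by apply: lee_sum => t _; apply: lee_wpmul2l; rewrite ?lee_fin.
Qed.
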